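(* Given $L\in\mathcal{L}$, let $A_1,\ldots,A_m$ be non-negative matrices that define operators on $L$. For $t\in[1,m]$ and $i=1,\ldots,m$, put $$P_i=A_i^{(t)}A_{i+1}^{(t)}\cdots A_m^{(t)}A_1^{(t)}A_2^{(t)}\cdots A_{i-1}^{(t)}.$$ Then $$\rho(A_1\circ\cdots\circ A_m)\le\rho\left(P_1^{(\frac1t)}\circ\cdots\circ P_m^{(\frac1t)}\right)^{\frac1m}\le\rho(A_1^{(t)}\cdots A_m^{(t)})^{\frac1t}\le\rho((A_1\cdots A_m)^{(t)})^{\frac1t}\le\rho(A_1\cdots A_m)$$ and $$\|(A_1\circ\cdots\circ A_m)^m\|\le\|P_1^{(\frac1t)}\circ\cdots\circ P_m^{(\frac1t)}\|\le\left(\|P_1\|\cdots\|P_m\|\right)^{\frac1t}$$ $$\le\left(\|(A_1A_2\cdots A_m)^{(t)}\|\,\|(A_2\cdots A_mA_1)^{(t)}\|\cdots\|(A_mA_1\cdots A_{m-1})^{(t)}\|\right)^{\frac1t}$$ $$\le\|A_1A_2\cdots A_m\|\,\|A_2\cdots A_mA_1\|\cdots\|A_mA_1\cdots A_{m-1}\|.$$ If, in addition, $L=l^2(R)$ and $t=m$, then $$w((A_1\circ\cdots\circ A_m)^m)\le w\left(P_1^{(\frac1m)}\circ\cdots\circ P_m^{(\frac1m)}\right)\le\left(w(P_1)\cdots w(P_m)\right)^{\frac1m}$$ $$\le\left(w((A_1A_2\cdots A_m)^{(m)})\,w((A_2\cdots A_mA_1)^{(m)})\cdots w((A_mA_1\cdots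 A_{m-1})^{(m)})\right)^{\frac1m}.$$
   Context: Let $R$ be either $\{1,\ldots,n\}$ for some $n\in\mathbb{N}$ or $\mathbb{N}$, and let $S(R)$ be the vector lattice of all complex sequences $(x_i)_{i\in R}$. A Banach space $L\subseteq S(R)$ is a Banach sequence space if $x\in S(R)$, $y\in L$ and $|x|\le|y|$ (coordinatewise) imply $x\in L$ and $\|x\|_L\le\|y\|_L$. $\mathcal{L}$ is the collection of all Banach sequence spaces $L$ such that $e_i=\chi_{\{i\}}\in L$ and $\|e_i\|_L=1$ for all $i\in R$. A matrix $A=[a_{ij}]_{i,j\in R}$ (possibly infinite) is non-negative if $a_{ij}\ge0$ for all $i,j\in R$. A non-negative matrix $A$ defines an operator on $L$ if $Ax\in L$ for all $x\in L$, where $(Ax)_i=\sum_{j\in R}a_{ij}x_j$; this operator is automatically bounded, and $A$ is identified with it. $\|A\|$ is the operator norm and $\rho(A)$ the spectral radius; juxtaposition is the ordinary matrix product. For non-negative matrices, $A\circ B=[a_{ij}b_{ij}]_{i,j\in R}$ is the Hadamard product and $A^{(t)}=[a_{ij}^t]_{i,j\in R}$, $t\ge0$, is the Hadamard power (with $0^0=1$). For $L\in\mathcal{L}$, all matrices occurring in the claim as arguments of $\rho$, $\|\cdot\|$ or $w$ define operators on $L$. For a bounded operator $T$ on $l^2(R)$ the numerical radius is $w(T)=\sup\{|\langle Tf,f\rangle|: f\in l^2(R),\ \|f\|_2=1\}$. *)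

(* Defs.v *)
From HB Require Import structures.
From mathcomp Require Import all_boot all_order all_algebra.
From mathcomp Require Import complex.
From mathcomp Require Import all_classical all_reals all_analysis.
From mathcomp Require Import showcase.summability.
Set Implicit Arguments.
Unset Strict Implicit.
Unset Printing Implicit Defensive.
Import Order.TTheory GRing.Theory Num.Theory.
Import numFieldNormedType.Exports.
Import ComplexField.Normc.
Local Open Scope classical_set_scope.
Local Open Scope complex_scope.
Local Open Scope ring_scope.

(* The index set R: [Initial n] is {1, ..., n + 1} (as 'I_n.+1, so that
   it is never empty) and [Naturals] is the set of all natural numbers. *)
Variant index_set := Initial of nat | Naturals.

Definition index_type (R : index_set) : choiceType :=
  match R with Initial n => 'I_n.+1 | Naturals => nat end.

(* In a normed module over K[i] the norm `|x| has type K[i]; it is a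
   non-negative real, so its real part is the usual real-valued norm. *)
Definition rnorm (K : realType) (V : normedModType K[i]) (x : V) : K :=
  complex.Re `|x|.

(* The inclusion of L into the space of all sequences is the injective
   linear map [bss_coord]; "x belongs to L" reads
   "[exists y : L, bss_coord y = x]". *)
Record banach_seq_space (K : realType) (I : choiceType) := BanachSeqSpace {
  bss_sort :> completeNormedModType K[i];
  bss_coord : {linear bss_sort -> (I -> K[i]^o)};
  bss_inj : injective bss_coord;
  bss_solid : forall (x : I -> K[i]) (y : bss_sort),
    (forall i, `|x i| <= `|bss_coord y i|) ->
    exists z : bss_sort, bss_coord z = x /\ `|z| <= `|y| }.
Arguments bss_coord {K I} _.

(* The class written as a calligraphic L in the source. *)
Definition normalized (K : realType) (I : choiceType)
    (L : banach_seq_space K I) : Prop :=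
  forall i : I, exists e : L, bss_coord L e = \1_[set i] /\ `|e| = 1.

Section Operators.
Variables (K : realType) (V : completeNormedModType K[i]) (f : V -> V).

Definition op_norm : K := sup [set rnorm (f x) | x in [set x : V | `|x| <= 1]].

Definition spectrum : set K[i] :=
  [set z | ~ exists g : {linear V -> V},
      [/\ continuous (g : V -> V),
          forall x, g (z *: x - f x) = x &
          forall x, z *: g x - f (g x) = x]].

Definition spectral_radius : K := sup [set normc z | z in spectrum].

End Operators.

Section Matrices.
Variables (K : realType) (I : choiceType).
Implicit Types A B : I -> I -> K.

Definition nonneg_mat A : Prop := forall i j, 0 <= A i j.

(* Entrywise sums of non-negative reals, hence [esum].  It is only used for
   non-negative matrices, and the sums are finite as soon as both factors
   define operators on a normalized Banach sequence space. *)
Definition mat_mul A B : I -> I -> K := fun i j =>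
  fine (\esum_(k in [set: I]) (A i k * B k j)%:E).

Definition mat_one : I -> I -> K := fun i j => (i == j)%:R.

Definition mat_exp A (m : nat) : I -> I -> K :=
  \big[mat_mul/mat_one]_(k < m) A.

Definition mat_prod (m : nat) (A : 'I_m -> I -> I -> K) : I -> I -> K :=
  \big[mat_mul/mat_one]_(j < m) A j.

(* A_i A_(i+1) ... A_m A_1 ... A_(i-1), indices starting at 0. *)
Definition cyclic_prod (m : nat) (A : 'I_m -> I -> I -> K) (i : 'I_m) :
    I -> I -> K :=
  \big[mat_mul/mat_one]_(j <- rot i (enum 'I_m)) A j.

Definition hadamard_prod (m : nat) (A : 'I_m -> I -> I -> K) : I -> I -> K :=
  fun i j => \prod_(k < m) A k i j.

(* [powR] satisfies 0 `^ 0 = 1. *)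
Definition hadamard_pow A (t : K) : I -> I -> K := fun i j => A i j `^ t.

Definition mat_act A (x : I -> K[i]) : I -> K[i] := fun i =>
  summability.sum (fun j => (A i j)%:C * x j : K[i]^o).

(* Convergence of the sums defining A x is part of "A x belongs to L".  The
   sums are unconditional; since |x| belongs to L whenever x does and A is
   non-negative, convergence of ordered partial sums for all x in L would
   give the same notion. *)
Definition defines_operator (L : banach_seq_space K I) A : Prop :=
  forall x : L,
    (forall i, cvg (partial_sum
        (fun j => (A i j)%:C * bss_coord L x j : K[i]^o) @ totally)) /\
    exists y : L, bss_coord L y = mat_act A (bss_coord L x).

(* The element is unique by [bss_inj]; 0 is only the value of [xget] when A
   does not define an operator on L. *)
Definition mat_op (L : banach_seq_space K I) A (x : L) : L :=
  xget 0 [set y : L | bss_coord L y = mat_act A (bss_coord L x)].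

(* The real suprema below are genuine (not the default value of [sup]):
   a non-negative matrix that defines an operator on L defines a bounded
   one. *)
Definition mat_norm (L : banach_seq_space K I) A : K :=
  op_norm (@mat_op L A).

Definition mat_rho (L : banach_seq_space K I) A : K :=
  spectral_radius (@mat_op L A).

Definition l2 : set (I -> K[i]) :=
  [set x | (\esum_(i in [set: I]) (normc (x i) ^+ 2)%:E < +oo)%E].

Definition l2_norm (x : I -> K[i]) : K :=
  Num.sqrt (fine (\esum_(i in [set: I]) (normc (x i) ^+ 2)%:E)).

Definition l2_inner (x y : I -> K[i]) : K[i] :=
  summability.sum (fun i => x i * conjc (y i) : K[i]^o).

Definition is_l2 (L : banach_seq_space K I) : Prop :=
  range (bss_coord L) = l2 /\
  forall x : L, rnorm x = l2_norm (bss_coord L x).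

Definition num_radius A : K :=
  sup [set normc (l2_inner (mat_act A x) x) | x in
        [set x | l2 x /\ l2_norm x = 1]].

End Matrices.

(* Main.v *)
Require Import Defs.
From HB Require Import structures.
From mathcomp Require Import all_boot all_order all_algebra finmap.
From mathcomp Require Import complex.
From mathcomp Require Import all_classical all_reals all_analysis.
From mathcomp Require Import showcase.summability.
From mathcomp Require Import zify ring lra.
Set Implicit Arguments.
Unset Strict Implicit.
Unset Printing Implicit Defensive.
Import Order.TTheory GRing.Theory Num.Theory.
Import numFieldNormedType.Exports.
Import ComplexField.Normc.
Local Open Scope classical_set_scope.
Local Open Scope complex_scope.
Local Open Scope ring_scope.

(* Everything rests on one inequality: if a functional nu on nonnegative functions is
   monotone, sublinear and bounds its argument pointwise, then AM-GM, applied after scaling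
   each nu (F_k) to 1, gives nu (F_1^a ... F_m^a) <= prod_k nu (F_k)^a as soon as m a >= 1
   (when m a = 1, a pointwise bound up to a constant factor suffices).
   For nu a sum over an index this says that a matrix product of Hadamard means is entrywise
   at most the Hadamard mean of the matrix products; for nu the operator norm or the
   numerical radius it gives the norm and numerical radius inequalities, applied to the
   entrywise bound (A_1 o ... o A_m)^m <= P_1^(1/t) o ... o P_m^(1/t).
   The spectral radius follows from norms of powers: for a nonnegative matrix it is the
   infimum of the s with norm (A^n) <= C s^n.  Above that infimum r the Neumann series
   inverts z - A.  Conversely, if r > 0 were not in the spectrum, the partial sums
   S_N = sum_(n <= N) (A / s)^n would be bounded uniformly in N and in s > r close to r; since
   (N + 1) (A / s)^N <= S_N S_N entrywise, norm (A^N) <= r^N / 2 for some N, against the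
   choice of r. *)

(** * Unconditional sums of nonnegative reals *)

Section Nsum.
Variables (K : realType).
Implicit Types (I J : choiceType).

(** Complex vectors enter only through |x|: since |A x| <= A |x|, the operator norm and the
    numerical radius are best constants over the non-negative cone, where monotonicity and
    subadditivity in the matrix are immediate ([mat_normP], [num_radiusP]). The interval for t is
    the condition m a >= 1 met twice: with m factors and a = 1/t it reads t <= m and gives the
    Hadamard product; with one factor and a = t it reads t >= 1 and compares P_i with the Hadamard
    power of a cyclic product of the A_j. For spectral radii, multiplicative constants are harmless
    because only the growth rate of powers counts. The hard half of the spectral radius formula is
    that r lies in the spectrum: approaching r from the right along the real axis keeps all terms of
    the resolvent series non-negative, so that a bound on a partial sum bounds each of its terms,
    and squaring the sum gains the factor N + 1. *)

Definition nsum I (f : I -> K) : K := fine (\esum_(i in [set: I]) (f i)%:E).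

(** [fine] sends an infinite sum to 0, so [nsum] is the true sum only under this predicate. *)
Definition summ I (f : I -> K) : Prop :=
  (forall i, 0 <= f i) /\ (\esum_(i in [set: I]) (f i)%:E < +oo)%E.

Lemma nsumE I (f : I -> K) : summ f ->
  (nsum f)%:E = \esum_(i in [set: I]) (f i)%:E.
Proof.
move=> [f0 foo]; rewrite fineK// ge0_fin_numE//.
by apply: esum_ge0 => i _; rewrite lee_fin.
Qed.

Lemma nsum_ge0 I (f : I -> K) : (forall i, 0 <= f i) -> 0 <= nsum f.
Proof. by move=> f0; apply/fine_ge0/esum_ge0 => i _; rewrite lee_fin. Qed.

Lemma summ_eq I (f : I -> K) (s : K) : (forall i, 0 <= f i) ->
  \esum_(i in [set: I]) (f i)%:E = s%:E -> summ f /\ nsum f = s.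
Proof. by move=> f0 fs; rewrite /summ /nsum fs/= ltry. Qed.

Lemma fset_le_nsum I (f : I -> K) (F : {fset I}) : summ f ->
  \sum_(i <- F) f i <= nsum f.
Proof.
move=> sf; rewrite -lee_fin nsumE// -sumEFin; apply: ereal_sup_ubound.
by exists [set` F] => //; rewrite fsbig_finite//= set_fsetK.
Qed.

Lemma nsum_le I (f : I -> K) (c : K) : (forall i, 0 <= f i) ->
  (forall F : {fset I}, \sum_(i <- F) f i <= c) -> summ f /\ nsum f <= c.
Proof.
move=> f0 fc.
have h : (\esum_(i in [set: I]) (f i)%:E <= c%:E)%E.
  apply: ge_ereal_sup => _ [F [finF _] <-].
  by rewrite fsbig_finite//= sumEFin lee_fin.
have sf : summ f by split=> //; rewrite (le_lt_trans h)// ltry.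
by split=> //; rewrite -lee_fin nsumE.
Qed.

Lemma le_nsum I (f g : I -> K) : (forall i, 0 <= f i <= g i) -> summ g ->
  summ f /\ nsum f <= nsum g.
Proof.
move=> fg sg; apply: nsum_le => [i|F]; first by case/andP: (fg i).
by rewrite (le_trans _ (fset_le_nsum F sg))// ler_sum// => i _; case/andP: (fg i).
Qed.

Lemma nsumD I (f g : I -> K) : summ f -> summ g ->
  summ (fun i => f i + g i) /\ nsum (fun i => f i + g i) = nsum f + nsum g.
Proof.
move=> sf sg; have [f0 _] := sf; have [g0 _] := sg.
apply: summ_eq => [i|]; first by rewrite addr_ge0.
rewrite EFinD !nsumE//; under eq_esum do rewrite EFinD.
by rewrite esumD// => i _; rewrite lee_fin.
Qed.

(** One inequality suffices: applied to c^-1 and the scaled family it gives the reverse one. *)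
Lemma nsumZ I (c : K) (f : I -> K) : 0 <= c -> summ f ->
  summ (fun i => c * f i) /\ nsum (fun i => c * f i) = c * nsum f.
Proof.
move=> c0 sf; have [f0 _] := sf.
have H (d : K) (h : I -> K) : 0 <= d -> summ h ->
    summ (fun i => d * h i) /\ nsum (fun i => d * h i) <= d * nsum h.
  move=> d0 sh; apply: nsum_le => [i|F]; first by rewrite mulr_ge0//; case: sh.
  by rewrite -mulr_sumr ler_wpM2l// fset_le_nsum.
have [sc lec] := H c f c0 sf; split=> //; apply/eqP; rewrite eq_le lec/=.
have [->|cn0] := eqVneq c 0.
  by rewrite mul0r nsum_ge0// => i; rewrite mul0r.
have {cn0}c1 : 0 < c by rewrite lt_def cn0.
have ci0 : 0 <= c^-1 by rewrite invr_ge0.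
have [_] := H c^-1 _ ci0 sc.
under eq_fun do rewrite mulrA mulVf ?gt_eqF// mul1r.
by rewrite mulrC ler_pdivlMr// mulrC.
Qed.

Lemma nsum_ge_term I (f : I -> K) i : summ f -> f i <= nsum f.
Proof. by move=> sf; have := fset_le_nsum [fset i]%fset sf; rewrite big_seq_fset1. Qed.

Lemma nsum1 I (f : I -> K) i : 0 <= f i -> (forall j, j != i -> f j = 0) ->
  summ f /\ nsum f = f i.
Proof.
move=> fi0 fj; have f0 j : 0 <= f j by have [->|/fj->] := eqVneq j i.
apply: summ_eq => //.
rewrite (esumID [set i])/=; last by move=> j _; rewrite lee_fin.
rewrite !setTI esum_set1 ?lee_fin// esum1 ?adde0// => j /= /eqP ji.
by rewrite fj.
Qed.

Lemma nsum_exchange I J (f : I -> J -> K) : (forall i j, 0 <= f i j) ->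
  (forall i, summ (f i)) -> summ (fun i => nsum (f i)) ->
  [/\ forall j, summ (f^~ j), summ (fun j => nsum (f^~ j)) &
    nsum (fun j => nsum (f^~ j)) = nsum (fun i => nsum (f i))].
Proof.
move=> f0 sf ssf.
have f0E i j : (0 <= (f i j)%:E)%E by rewrite lee_fin.
have sj j : summ (f^~ j).
  by have [] := @le_nsum I (f^~ j) _ _ ssf => // i; rewrite f0/= nsum_ge_term.
suff [? ?] : summ (fun j => nsum (f^~ j)) /\
    nsum (fun j => nsum (f^~ j)) = nsum (fun i => nsum (f i)) by [].
apply: summ_eq => [j|]; first by rewrite nsum_ge0.
rewrite nsumE//.
under eq_esum do rewrite nsumE//.
under [RHS]eq_esum do rewrite nsumE//.
rewrite !esum_esum// (reindex_esum ([set: I] `*`` fun=> [set: J]) _ (fun x => (x.2, x.1)))//.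
split => //= [[i j] [i' j'] /= _ _ [-> ->]//|[i j] _]; by exists (j, i).
Qed.

End Nsum.

(** * Monotone sublinear functionals and geometric means *)

Lemma le_powR (K : realType) (a b e : K) :
  0 <= e -> 0 <= a -> a <= b -> a `^ e <= b `^ e.
Proof.
move=> e0 a0 ab; apply: (ge0_ler_powR e0) => //; rewrite nnegrE//.
exact: le_trans ab.
Qed.

Section GeometricMean.
Variable (K : realType).

Lemma powR_prod (J : Type) (s : seq J) (E : J -> K) (a : K) :
  (forall k, 0 <= E k) ->
  (\prod_(k <- s) E k) `^ a = \prod_(k <- s) (E k `^ a).
Proof.
move=> E0; elim: s => [|k s IH]; first by rewrite !big_nil powR1.
by rewrite !big_cons powRM ?IH// prodr_ge0.
Qed.

Lemma geom_le_arith (m : nat) (E : 'I_m -> K) : (0 < m)%N ->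
  (forall k, 0 <= E k) ->
  \prod_(k < m) (E k `^ m%:R^-1) <= \sum_(k < m) E k / m%:R.
Proof.
move=> m0 E0; have := @leif_AGM K 'I_m 'I_m E (fun k _ => E0 k).
rewrite card_ord -mulr_suml => /leif_le h.
have S0 : 0 <= (\sum_(k in 'I_m) E k) / m%:R.
  by rewrite divr_ge0// sumr_ge0.
have mne0 : m%:R != 0 :> K by rewrite pnatr_eq0 -lt0n.
have := ge0_ler_powR (r := m%:R^-1) _ _ _ h.
rewrite !nnegrE invr_ge0 ler0n prodr_ge0// exprn_ge0// => /(_ _ _ _)/=.
by rewrite -[X in _ <= X `^ _]powR_mulrn// -powRrM divff// powRr1// powR_prod// => ->.
Qed.

(** Each closure axiom also returns membership in [dom], so the mean inequality proves at the same
    time that the mean lies in the domain; for matrices, that it defines an operator. [T] will be I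
    for sums and I * I for matrices seen as functions of their entries. *)
Record monotone_sublinear (T : Type) (kappa : K) (dom : (T -> K) -> Prop)
    (nu : (T -> K) -> K) : Prop := MonotoneSublinear {
  msl_ge0 : forall f x, dom f -> 0 <= f x;
  msl_nu_ge0 : forall f, dom f -> 0 <= nu f;
  msl_bound : forall f x, dom f -> f x <= kappa * nu f;
  msl_le : forall f g, dom g -> (forall x, 0 <= f x <= g x) ->
    dom f /\ nu f <= nu g;
  msl0 : dom (fun=> 0) /\ nu (fun=> 0) <= 0;
  mslD : forall f g, dom f -> dom g ->
    dom (fun x => f x + g x) /\ nu (fun x => f x + g x) <= nu f + nu g;
  mslZ : forall c f, 0 <= c -> dom f ->
    dom (fun x => c * f x) /\ nu (fun x => c * f x) <= c * nu f }.

Section Theory.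
Variables (T : Type) (kappa : K) (dom : (T -> K) -> Prop) (nu : (T -> K) -> K).
Hypothesis nuP : monotone_sublinear kappa dom nu.

Lemma msl_lincomb (J : Type) (s : seq J) (c : J -> K) (F : J -> T -> K) :
  (forall k, 0 <= c k) -> (forall k, dom (F k)) ->
  dom (fun x => \sum_(k <- s) c k * F k x) /\
  nu (fun x => \sum_(k <- s) c k * F k x) <= \sum_(k <- s) c k * nu (F k).
Proof.
move=> c0 dF; elim: s => [|k s [IHd IHn]].
  by under eq_fun do rewrite big_nil; rewrite big_nil; exact: msl0 nuP.
under eq_fun do rewrite big_cons; rewrite big_cons.
have [dk nk] := mslZ nuP (c0 k) (dF k).
have [dD nD] := mslD nuP dk IHd; split=> //.
by rewrite (le_trans nD)// lerD.
Qed.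

(* After scaling so that every nu (F k) is 1, this is the AM-GM inequality; the
   excess a - 1/m of the exponent is absorbed by the pointwise bound. *)
Lemma msl_geometric_mean (m : nat) (a : K) (F : 'I_m -> T -> K) :
  (0 < m)%N -> 1 <= m%:R * a -> 0 <= kappa -> (forall k, dom (F k)) ->
  dom (fun x => \prod_(k < m) F k x `^ a) /\
  nu (fun x => \prod_(k < m) F k x `^ a) <=
    kappa `^ (m%:R * a - 1) * \prod_(k < m) nu (F k) `^ a.
Proof.
move=> m0 ma k0 dF.
have mgt0 : 0 < m%:R :> K by rewrite ltr0n.
have a0 : 0 < a by rewrite -(pmulr_rgt0 _ mgt0) (lt_le_trans ltr01).
have f0 k x : 0 <= F k x by exact: (msl_ge0 nuP).
have n0 k : 0 <= nu (F k) by exact: (msl_nu_ge0 nuP).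
have P0 x : 0 <= \prod_(k < m) F k x `^ a by apply: prodr_ge0 => k _; rewrite powR_ge0.
(* If some nu (F k) is 0 it cannot be scaled to 1, but the pointwise bound forces F k = 0 and the
   mean vanishes. *)
have [[k nk]|nn0] := pselect (exists k, nu (F k) = 0).
  have z x : \prod_(k < m) F k x `^ a = 0.
    rewrite (bigD1 k)//=; have -> : F k x = 0.
      by apply/eqP; rewrite eq_le f0 andbT -(mulr0 kappa) -nk (msl_bound nuP).
    by rewrite powR0 ?mul0r// gt_eqF.
  under eq_fun do rewrite z.
  have [d0 nu0] := msl0 nuP; split=> //; rewrite (le_trans nu0)// mulr_ge0 ?powR_ge0//.
  by apply: prodr_ge0 => ? _; rewrite powR_ge0.
have {n0 nn0}n0 k : 0 < nu (F k).
  by rewrite lt_def n0 andbT; apply/eqP => nk; apply: nn0; exists k.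
set C := kappa `^ _ * _.
have C0 : 0 <= C.
  by rewrite mulr_ge0 ?powR_ge0//; apply: prodr_ge0 => ? _; rewrite powR_ge0.
(* Each of the m terms c k * nu (F k) equals C / m, so they add up to the target C. *)
pose c k := C / m%:R / nu (F k).
have c0 k : 0 <= c k by rewrite /c !divr_ge0 ?ler0n// ltW.
have [dS nS] := msl_lincomb (index_enum 'I_m) c0 dF.
have le x : 0 <= \prod_(k < m) F k x `^ a <= \sum_(k < m) c k * F k x.
  rewrite P0/=.
  pose g k := F k x / nu (F k).
  have g0 k : 0 <= g k by rewrite divr_ge0// ltW.
  have Fg k : F k x = nu (F k) * g k by rewrite mulrC divfK// gt_eqF.
  have gk k : g k <= kappa by rewrite ler_pdivrMr//; exact: (msl_bound nuP).
  have e0 : 0 <= a - m%:R^-1.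
    by rewrite subr_ge0 -(ler_pM2l mgt0) divff// gt_eqF.
  have ga k : g k `^ a <= kappa `^ (a - m%:R^-1) * g k `^ m%:R^-1.
    have -> : a = (a - m%:R^-1) + m%:R^-1 by rewrite subrK.
    rewrite [X in X <= _]powRD; last first.
      by rewrite subrK (gt_eqF a0).
    rewrite addrK ler_wpM2r ?powR_ge0//.
    by apply: ge0_ler_powR; rewrite ?nnegrE.
  have step : \prod_(k < m) F k x `^ a <=
      \prod_(k < m) (nu (F k) `^ a * (kappa `^ (a - m%:R^-1) * g k `^ m%:R^-1)).
    apply: ler_prod => k _; rewrite powR_ge0/= {1}Fg powRM ?(ltW (n0 k))//.
    by rewrite ler_wpM2l ?powR_ge0.
  apply: le_trans step _.
  have -> : \sum_(k < m) c k * F k x = C * \sum_(k < m) g k / m%:R.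
    by rewrite mulr_sumr; apply: eq_bigr => k _; rewrite /c /g; ring.
  rewrite big_split/= big_split/= prodr_const card_ord -powR_mulrn ?powR_ge0//.
  rewrite -powRrM mulrBl mulVf ?gt_eqF// (mulrC a) mulrA [X in X * _]mulrC.
  by rewrite ler_wpM2l// geom_le_arith.
have [dom_f nu_f] := msl_le nuP dS le; split=> //.
rewrite (le_trans nu_f)// (le_trans nS)//.
under eq_bigr do rewrite divfK ?gt_eqF//.
by rewrite sumr_const card_ord -[_ *+ m]mulr_natr divfK// gt_eqF.
Qed.

End Theory.

Lemma nsum_monotone_sublinear (I : choiceType) :
  monotone_sublinear 1 (@summ K I) (@nsum K I).
Proof.
split=> [f x []//|f [f0 _]|f x sf|f g sg fg||f g sf sg|c f c0 sf].
- exact: nsum_ge0.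
- by rewrite mul1r nsum_ge_term.
- exact: le_nsum.
- by apply: nsum_le => // F; rewrite big1.
- by have [? ->] := nsumD sf sg.
- by have [? ->] := nsumZ c0 sf.
Qed.

End GeometricMean.

(** * Unconditional sums of complex numbers *)

Section ComplexSums.
Variable (K : realType).
Implicit Types (I : choiceType).

Lemma norm_normc (z : K[i]) : `|z| = (normc z)%:C.
Proof. by []. Qed.

Lemma normc_ge0 (z : K[i]) : 0 <= normc z.
Proof. by case: z => a b; exact: sqrtr_ge0. Qed.

Lemma normc_real (x : K) : normc x%:C = `|x|.
Proof. by rewrite /= expr0n addr0 sqrtr_sqr. Qed.

#[local] Existing Instance totally_filter.

Definition has_csum I (f : I -> K[i]) (s : K[i]) : Prop :=
  partial_sum (f : I -> K[i]^o) @ totally --> (s : K[i]^o).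

Lemma has_csumP I (f : I -> K[i]) s : has_csum f s <->
  forall e : K, 0 < e -> exists F : {fset I}, forall G : {fset I}, (F `<=` G)%fset ->
    normc (s - \sum_(i <- G) f i) < e.
Proof.
split=> [/cvgrPdist_lt h e e0|h].
  have /h [F _ FG] : (0 : K[i]) < e%:C by rewrite ltcR.
  by exists F => G /FG; rewrite /partial_sum -(big_seq_fsetE _ _ xpredT) norm_normc ltcR.
apply/cvgrPdist_lt => e; rewrite ltcE => /andP[/= /eqP ei er].
have {ei}-> : e = (complex.Re e)%:C by case: e ei {er} => a b /= ->.
have [F FG] := h _ er; exists F => // G /FG.
by rewrite /partial_sum -(big_seq_fsetE _ _ xpredT) norm_normc ltcR.
Qed.

Lemma has_csum_sum I (f : I -> K[i]) s : has_csum f s ->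
  summability.sum (f : I -> K[i]^o) = s.
Proof. by move=> h; exact: (cvg_lim (@norm_hausdorff _ K[i]^o) h). Qed.

Lemma has_csumD I (f g : I -> K[i]) s t : has_csum f s -> has_csum g t ->
  has_csum (fun i => f i + g i) (s + t).
Proof.
move=> fs gt; rewrite /has_csum.
have -> : partial_sum (fun i => f i + g i : K[i]^o) =
    (fun F => partial_sum (f : I -> K[i]^o) F + partial_sum (g : I -> K[i]^o) F).
  by apply/funext => F; rewrite /partial_sum -big_split.
exact: cvgD fs gt.
Qed.

Lemma has_csumZ I (c : K[i]) (f : I -> K[i]) s : has_csum f s ->
  has_csum (fun i => c * f i) (c * s).
Proof.
move=> fs; rewrite /has_csum.
have -> : partial_sum (fun i => c * f i : K[i]^o) =
    (fun F => c *: partial_sum (f : I -> K[i]^o) F).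
  by apply/funext => F; rewrite /partial_sum scaler_sumr.
exact: cvgZr fs.
Qed.

Lemma has_csum_nneg I (f : I -> K) : summ f ->
  has_csum (fun i => (f i)%:C) (nsum f)%:C.
Proof.
move=> sf; apply/has_csumP => e e0.
have [F Fe] : exists F : {fset I}, nsum f - e < \sum_(i <- F) f i.
  apply/not_existsP => h.
  suff [_] : summ f /\ nsum f <= nsum f - e by rewrite leNgt ltrBlDr ltrDl e0.
  apply: nsum_le => [|F]; first by case: sf.
  by rewrite leNgt; apply/negP/h.
exists F => G FG; rewrite -rmorph_sum -rmorphB.
rewrite normc_real ger0_norm ?subr_ge0 ?fset_le_nsum//.
rewrite ltrBlDl -ltrBlDr (lt_le_trans Fe)//.
have [f0 _] := sf.
rewrite -(fsetUidPr _ _ FG) [leRHS](big_fsetID _ (mem F))/=.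
rewrite [X in X + _](_ : _ = \sum_(i <- F) f i); last first.
  apply: eq_fbigl => i; rewrite !inE/=; case: (i \in F); by rewrite ?andbF ?andbT.
by rewrite lerDl sumr_ge0.
Qed.

Lemma has_csum_le I (f : I -> K[i]) s (c : K) : has_csum f s ->
  (forall F : {fset I}, \sum_(i <- F) normc (f i) <= c) -> normc s <= c.
Proof.
move=> /has_csumP h fc; apply/ler_addgt0Pr => e e0.
have [F /(_ F (fsubset_refl _)) Fe] := h e e0.
suff Ff : normc (\sum_(i <- F) f i) <= \sum_(i <- F) normc (f i).
  have := le_normcD (s - \sum_(i <- F) f i) (\sum_(i <- F) f i).
  by rewrite subrK; have := fc F; lra.
elim/big_ind2 : _ => [|a b a' b' h1 h2|//]; first by rewrite normc0.
by rewrite (le_trans (le_normcD _ _))// lerD.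
Qed.

(** The positive and negative parts of the real and imaginary parts of f are all dominated by |f|,
    which reduces convergence to non-negative families. *)
Lemma has_csum_normc I (f : I -> K[i]) : summ (fun i => normc (f i)) ->
  exists2 s, has_csum f s & normc s <= nsum (fun i => normc (f i)).
Proof.
move=> sf.
have part (g : I -> K) : (forall i, 0 <= g i <= normc (f i)) ->
    has_csum (fun i => (g i)%:C) (nsum g)%:C.
  by move=> gf; apply: has_csum_nneg; have [] := le_nsum gf sf.
pose p (x : K) := (`|x| + x) / 2; pose n (x : K) := (`|x| - x) / 2.
have pn x y (z := x +i* y) : [/\ 0 <= p x <= normc z, 0 <= n x <= normc z,
    0 <= p y <= normc z & 0 <= n y <= normc z].
  have xz : `|x| <= normc z.
    by rewrite -sqrtr_sqr ler_wsqrtr// lerDl sqr_ge0.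
  have yz : `|y| <= normc z.
    by rewrite -sqrtr_sqr ler_wsqrtr// lerDr sqr_ge0.
  have := ler_norm x; have := ler_norm (- x); have := ler_norm y; have := ler_norm (- y).
  by rewrite !normrN /p /n => *; split; apply/andP; split; lra.
have [/part h1 /part h2 /part h3 /part h4] : [/\
    forall i, 0 <= p (complex.Re (f i)) <= normc (f i),
    forall i, 0 <= n (complex.Re (f i)) <= normc (f i),
    forall i, 0 <= p (complex.Im (f i)) <= normc (f i) &
    forall i, 0 <= n (complex.Im (f i)) <= normc (f i)].
  by split=> i; case: (f i) => x y; have [] := pn x y.
have [s fs] : exists s, has_csum f s.
  have -> : f = fun i => ((p (complex.Re (f i)))%:C + (-1) * (n (complex.Re (f i)))%:C)
     + 'i * ((p (complex.Im (f i)))%:C + (-1) * (n (complex.Im (f i)))%:C).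
    apply/funext => i; rewrite !mulN1r -!rmorphB/= /p /n -!mulrBl !opprB.
    have two (x : K) : (`|x| + x + (x - `|x|)) / 2 = x by field.
    by rewrite !two; case: (f i) => x y; simpc.
  eexists; apply: has_csumD; last apply: has_csumZ.
    by apply: has_csumD; [exact: h1 | apply: has_csumZ; exact: h2].
  by apply: has_csumD; [exact: h3 | apply: has_csumZ; exact: h4].
exists s => //; apply: has_csum_le fs _ => F; exact: fset_le_nsum.
Qed.

End ComplexSums.

(** * The real-valued norm and geometric series in complex Banach spaces *)

Section RealNorm.
Variables (K : realType) (V : normedModType K[i]).
Implicit Types (x y : V).

Lemma rnormE x : `|x| = (rnorm x)%:C.
Proof.
have := normr_ge0 x; rewrite /rnorm lecE => /andP[/= /eqP h _].
by case: `|x| h => a b /= ->.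
Qed.

Lemma rnorm_ge0 x : 0 <= rnorm x.
Proof. by have := normr_ge0 x; rewrite rnormE lecR. Qed.

Lemma ler_rnormD x y : rnorm (x + y) <= rnorm x + rnorm y.
Proof. by have := ler_normD x y; rewrite !rnormE -rmorphD lecR. Qed.

Lemma rnormZ (z : K[i]) x : rnorm (z *: x) = normc z * rnorm x.
Proof. by have := normrZ z x; rewrite !rnormE norm_normc -rmorphM => /complexI. Qed.

Lemma rnormN x : rnorm (- x) = rnorm x.
Proof. by rewrite /rnorm normrN. Qed.

Lemma rnorm0 : rnorm (0 : V) = 0.
Proof. by rewrite /rnorm normr0. Qed.

Lemma rnorm_eq0 x : rnorm x = 0 -> x = 0.
Proof. by move=> h; apply/eqP; rewrite -normr_eq0 rnormE h. Qed.

Lemma ler_rnorm_sum (J : Type) (s : seq J) (F : J -> V) :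
  rnorm (\sum_(j <- s) F j) <= \sum_(j <- s) rnorm (F j).
Proof.
elim/big_ind2 : _ => [|a b a' b' h1 h2|//]; first by rewrite rnorm0.
by rewrite (le_trans (ler_rnormD _ _))// lerD.
Qed.

End RealNorm.

Lemma geometric_lt (K : realType) (c q e : K) : 0 <= q < 1 -> 0 < e ->
  exists M, c * q ^+ M < e.
Proof.
move=> /andP[q0 q1] e0.
have h : (fun n => c * q ^+ n) @ \oo --> (0 : K).
  by rewrite -(mulr0 c); apply: cvgMr; apply: cvg_expr; rewrite ger0_norm.
have /cvgrPdist_lt /(_ e e0) [M _ /(_ M (leqnn M))/=] := h.
by rewrite sub0r normrN => /(le_lt_trans (ler_norm _)) ?; exists M.
Qed.

Lemma geometric_sum_le (K : realType) (q : K) (n k : nat) : 0 <= q < 1 ->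
  \sum_(n <= i < n + k) q ^+ i <= q ^+ n / (1 - q).
Proof.
move=> /andP[q0 q1]; have q10 : 0 < 1 - q by rewrite subr_gt0.
rewrite ler_pdivlMr//.
suff -> : (\sum_(n <= i < n + k) q ^+ i) * (1 - q) = q ^+ n - q ^+ (n + k).
  by rewrite lerBlDr lerDl exprn_ge0.
elim: k => [|k IH]; first by rewrite addn0 big_geq// mul0r subrr.
rewrite addnS big_nat_recr/= ?leq_addr// mulrDl IH exprS; ring.
Qed.

(** Serves both the Neumann series and the series in [posop_bounded]. The remainder bound at every M
    lets later arguments handle finite sums only. *)
Lemma geometric_series_cvg (K : realType) (V : completeNormedModType K[i])
    (x : nat -> V) (c q : K) : 0 <= q < 1 -> 0 <= c ->
  (forall n, rnorm (x n) <= c * q ^+ n) ->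
  exists y, forall M, rnorm (y - \sum_(0 <= n < M) x n) <= c / (1 - q) * q ^+ M.
Proof.
move=> q01 c0 xq; have /andP[q0 q1] := q01.
pose s M := \sum_(0 <= n < M) x n; pose B M := c / (1 - q) * q ^+ M.
have sB M k : rnorm (s (M + k)%N - s M) <= B M.
  rewrite /s (big_cat_nat (leq0n M) (leq_addr k M))/= addrAC subrr add0r.
  rewrite (le_trans (ler_rnorm_sum _ _))// (le_trans (ler_sum _ (fun n _ => xq n)))//.
  by rewrite -mulr_sumr /B mulrAC -mulrA ler_wpM2l// geometric_sum_le.
have cs : cvg (s @ \oo).
  apply/cauchy_cvgP/cauchy_exP => e; rewrite ltcE => /andP[/= /eqP ei er].
  have {ei}eE : e = (complex.Re e)%:C by case: e ei {er} => a b /= ->.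
  have [M Me] := geometric_lt (c / (1 - q)) q01 er.
  exists (s M); exists M => // n /= Mn; rewrite -ball_normE/= eE rnormE ltcR.
  by rewrite -opprB rnormN -(subnKC Mn) (le_lt_trans (sB _ _)).
exists (lim (s @ \oo)) => M; rewrite -/(s M) -/(B M).
apply/ler_addgt0Pr => e e0.
have e0C : (0 : K[i]) < e%:C by rewrite ltcR.
have /cvgrPdist_lt /(_ _ e0C) [n _ /(_ (M + n)%N (leq_addl _ _))/=] := cs.
rewrite rnormE ltcR => h.
have := ler_rnormD (lim (s @ \oo) - s (M + n)%N) (s (M + n)%N - s M).
by rewrite addrA subrK; have := sB M n; lra.
Qed.

(** * Nonnegative operators on Banach sequence spaces *)

Section Lattice.
Variables (K : realType) (I : choiceType) (L : banach_seq_space K I).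
Hypothesis hL : normalized L.
Local Notation c := (bss_coord L).
Implicit Types (u v : I -> K) (A B : I -> I -> K).

Lemma bss_solid_normc (x : I -> K[i]) (y : L) :
  (forall i, normc (x i) <= normc (c y i)) ->
  exists z : L, c z = x /\ rnorm z <= rnorm y.
Proof.
move=> xy; have [|z [cz zy]] := @bss_solid K I L x y.
  by move=> i; rewrite !norm_normc lecR.
by exists z; split=> //; move: zy; rewrite !rnormE lecR.
Qed.

Lemma bss_coordZ (z : K[i]) (y : L) i : c (z *: y) i = z * c y i.
Proof. by rewrite linearZ. Qed.

Lemma bss_coordD (x y : L) i : c (x + y) i = c x i + c y i.
Proof. by rewrite linearD. Qed.

Lemma bss_coordB (x y : L) i : c (x - y) i = c x i - c y i.
Proof. by rewrite linearB. Qed.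

Lemma bss_coord_sum (J : Type) (s : seq J) (x : J -> L) i :
  c (\sum_(j <- s) x j) i = \sum_(j <- s) c (x j) i.
Proof. by rewrite linear_sum fct_sumE. Qed.

Lemma indic_set1 (i j : I) : (\1_[set i] : I -> K[i]) j = (j == i)%:R.
Proof.
rewrite indicE; congr (_%:R); congr nat_of_bool.
by apply/idP/eqP; rewrite inE.
Qed.

(** The vector y_i e_i lies below |y|, so solidity compares its norm |y_i| with that of y. *)
Lemma bss_coord_le (y : L) i : normc (c y i) <= rnorm y.
Proof.
have [e [ce e1]] := hL i.
have [j|z [cz zy]] := @bss_solid_normc (c (c y i *: e)) y.
  rewrite bss_coordZ ce indic_set1 normcM; have [->|ij] := eqVneq j i.
    by rewrite normc1 mulr1.
  by rewrite normc0 mulr0 normc_ge0.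
rewrite (le_trans _ zy)// (bss_inj cz) rnormZ.
by have -> : rnorm e = 1; [rewrite /rnorm e1 | rewrite mulr1].
Qed.

Definition of_real u : I -> K[i] := fun i => (u i)%:C.

Definition inL u : Prop := (forall i, 0 <= u i) /\ exists y : L, c y = of_real u.

(** The norm of L carried over to real sequences; outside L the default of [xget] makes it 0. *)
Definition nrm u : K := rnorm (xget (0 : L) [set y | c y = of_real u]).

Lemma nrm_eq u (y : L) : c y = of_real u -> nrm u = rnorm y.
Proof.
rewrite /nrm => cy; case: xgetP => [z _ /= cz|/(_ y)//].
by congr rnorm; apply: (@bss_inj _ _ L); rewrite cz cy.
Qed.

Lemma inL_repr u : inL u -> exists2 y : L, c y = of_real u & rnorm y = nrm u.
Proof. by move=> [_ [y cy]]; exists y => //; rewrite (nrm_eq cy). Qed.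

Lemma inL_ge0 u i : inL u -> 0 <= u i.
Proof. by case. Qed.

Lemma nrm_ge0 u : 0 <= nrm u.
Proof. exact: rnorm_ge0. Qed.

Lemma inL_dom u (y : L) : (forall i, 0 <= u i <= normc (c y i)) ->
  inL u /\ nrm u <= rnorm y.
Proof.
move=> uy; have [i|z [cz zy]] := @bss_solid_normc (of_real u) y.
  by have /andP[? ?] := uy i; rewrite normc_real ger0_norm.
rewrite (nrm_eq cz); split=> //; split; last by exists z.
by move=> i; case/andP: (uy i).
Qed.

(** x and |x| dominate each other, so solidity applies in both directions. This is the passage from
    complex to non-negative vectors. *)
Lemma inL_abs (x : L) : inL (fun i => normc (c x i)) /\
  nrm (fun i => normc (c x i)) = rnorm x.
Proof.
have [i|ux nx] := @inL_dom (fun i => normc (c x i)) x; first by rewrite normc_ge0/=.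
split=> //; apply/eqP; rewrite eq_le nx/=.
have [y cy <-] := inL_repr ux.
have [i|z [cz zy]] := @bss_solid_normc (c x) y.
  by rewrite cy normc_real ger0_norm ?normc_ge0.
by rewrite -(bss_inj cz).
Qed.

Lemma inL_le u v : inL v -> (forall i, 0 <= u i <= v i) -> inL u /\ nrm u <= nrm v.
Proof.
move=> /inL_repr[y cy <-] uv; apply: inL_dom => i.
have /andP[u0 le] := uv i.
by rewrite cy normc_real ger0_norm ?u0// (le_trans u0).
Qed.

Lemma inL_coord_le u i : inL u -> u i <= nrm u.
Proof.
move=> uL; have [y cy <-] := inL_repr uL.
by have := bss_coord_le y i; rewrite cy normc_real ger0_norm ?inL_ge0.
Qed.

Lemma inLD u v : inL u -> inL v -> inL (fun i => u i + v i) /\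
  nrm (fun i => u i + v i) <= nrm u + nrm v.
Proof.
move=> uL vL; have [x cx <-] := inL_repr uL; have [y cy <-] := inL_repr vL.
have cxy : c (x + y) = of_real (fun i => u i + v i).
  by apply/funext => i; rewrite bss_coordD cx cy /of_real rmorphD.
rewrite (nrm_eq cxy) ler_rnormD; split=> //; split; last by exists (x + y).
by move=> i; rewrite addr_ge0 ?inL_ge0.
Qed.

Lemma inLZ a u : 0 <= a -> inL u -> inL (fun i => a * u i) /\
  nrm (fun i => a * u i) = a * nrm u.
Proof.
move=> a0 uL; have [x cx <-] := inL_repr uL.
have cy : c (a%:C *: x) = of_real (fun i => a * u i).
  by apply/funext => i; rewrite bss_coordZ cx /of_real rmorphM.
rewrite (nrm_eq cy) rnormZ normc_real ger0_norm//; split=> //; split.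
  by move=> i; rewrite mulr_ge0 ?(inL_ge0 _ uL).
by exists (a%:C *: x).
Qed.

Lemma inL_delta j : inL (fun i => (i == j)%:R) /\ nrm (fun i => (i == j)%:R) = 1.
Proof.
have [e [ce e1]] := hL j.
have h : c e = of_real (fun i => (i == j)%:R).
  by apply/funext => i; rewrite ce indic_set1 /of_real; case: (i == j).
rewrite (nrm_eq h) /rnorm e1; split=> //; split; last by exists e.
by move=> i; rewrite ler0n.
Qed.

Definition act A u : I -> K := fun i => nsum (fun j => A i j * u j).

(** Takes the place of [defines_operator]: only non-negative vectors are tested, so closure under
    domination, sums and products involves order arguments alone. *)
Definition posop A : Prop := nonneg_mat A /\
  forall u, inL u -> (forall i, summ (fun j => A i j * u j)) /\ inL (act A u).

Lemma posop_ge0 A i j : posop A -> 0 <= A i j.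
Proof. by case. Qed.

Lemma posop_summ A u i : posop A -> inL u -> summ (fun j => A i j * u j).
Proof. by move=> [_ h] /h[]. Qed.

Lemma posop_inL A u : posop A -> inL u -> inL (act A u).
Proof. by move=> [_ h] /h[]. Qed.

Lemma act_le A B u v i : (forall i j, 0 <= A i j <= B i j) ->
  (forall j, 0 <= u j <= v j) -> posop B -> inL v ->
  act A u i <= act B v i.
Proof.
move=> AB uv pB vL; have [] // := @le_nsum K I (fun j => A i j * u j) (fun j => B i j * v j).
  move=> j; have /andP[a0 ab] := AB i j; have /andP[u0 uv'] := uv j.
  by rewrite mulr_ge0//= ler_pM.
exact: posop_summ.
Qed.

Lemma act_ge0 A u i : nonneg_mat A -> (forall j, 0 <= u j) -> 0 <= act A u i.
Proof. by move=> A0 u0; apply: nsum_ge0 => j; rewrite mulr_ge0. Qed.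

Lemma posop_le A B : posop B -> (forall i j, 0 <= A i j <= B i j) -> posop A.
Proof.
move=> pB AB; have A0 : nonneg_mat A by move=> i j; case/andP: (AB i j).
split=> // u uL; split=> [i|].
  have [] // := @le_nsum K I (fun j => A i j * u j) (fun j => B i j * u j).
    move=> j; rewrite mulr_ge0 ?(inL_ge0 _ uL)//= ler_wpM2r ?(inL_ge0 _ uL)//.
    by case/andP: (AB i j).
  exact: posop_summ.
have [] // := @inL_le (act A u) (act B u) => [|i]; first exact: posop_inL.
rewrite act_ge0//=; last by move=> j; exact: inL_ge0.
by apply: act_le => // j; rewrite (inL_ge0 _ uL)/=.
Qed.

Lemma has_csum_act A (x : L) i : posop A ->
  exists2 s, has_csum (fun j => (A i j)%:C * c x j) s &
    normc s <= act A (fun j => normc (c x j)) i.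
Proof.
move=> pA; have [xL _] := inL_abs x.
have E : (fun j => normc ((A i j)%:C * c x j)) = (fun j => A i j * normc (c x j)).
  by apply/funext => j; rewrite normcM normc_real ger0_norm ?posop_ge0.
by rewrite /act -E; apply: has_csum_normc; rewrite E; exact: posop_summ.
Qed.

Lemma mat_act_le A (x : L) i : posop A ->
  normc (mat_act A (c x) i) <= act A (fun j => normc (c x j)) i.
Proof. by move=> /(has_csum_act x i)[s hs]; rewrite /mat_act (has_csum_sum hs). Qed.

Lemma mat_act_has_csum A (x : L) i : posop A ->
  has_csum (fun j => (A i j)%:C * c x j) (mat_act A (c x) i).
Proof. by move=> /(has_csum_act x i)[s hs _]; rewrite /mat_act (has_csum_sum hs). Qed.

Lemma mat_act_real A u : nonneg_mat A -> (forall i, summ (fun j => A i j * u j)) ->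
  mat_act A (of_real u) = of_real (act A u).
Proof.
move=> A0 su; apply/funext => i; apply: has_csum_sum.
have -> : (fun j => (A i j)%:C * of_real u j) = (fun j => (A i j * u j)%:C).
  by apply/funext => j; rewrite rmorphM.
exact: has_csum_nneg.
Qed.

Lemma defines_operator_posop A : nonneg_mat A -> defines_operator L A -> posop A.
Proof.
move=> A0 dA; split=> // u uL.
have [y cy _] := inL_repr uL; have [cvg_y [z cz]] := dA y.
have su i : summ (fun j => A i j * u j).
  have /cvg_ex[/= s] := cvg_y i.
  rewrite cy => /has_csumP /(_ 1 ltr01)[F Fs].
  have f0 j : 0 <= A i j * u j by rewrite mulr_ge0 ?(inL_ge0 _ uL).
  (* Only sums over supersets of F are known to be within 1 of s, so G is enlarged by F;
     non-negativity then bounds the sum over G by |s| + 1. *)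
  have [] // := @nsum_le K I (fun j => A i j * u j) (normc s + 1) => // G.
  have := Fs _ (fsubsetUl F G).
  have E : \sum_(j <- (F `|` G)%fset) (A i j)%:C * of_real u j =
      (\sum_(j <- (F `|` G)%fset) (A i j * u j))%:C.
    by rewrite rmorph_sum; apply: eq_bigr => j _; rewrite rmorphM.
  rewrite E => lt1.
  have le1 : \sum_(j <- G) A i j * u j <= \sum_(j <- (F `|` G)%fset) (A i j * u j).
    rewrite [leRHS](big_fsetID _ (mem G))/=.
    rewrite [X in X + _](_ : _ = \sum_(j <- G) A i j * u j); last first.
      by apply: eq_fbigl => j; rewrite !inE/=; case: (j \in G); rewrite ?andbF ?andbT ?orbT.
    by rewrite lerDl sumr_ge0.
  have := le_normcD s (- (s - (\sum_(j <- (F `|` G)%fset) (A i j * u j))%:C)).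
  rewrite normcN opprB addrCA subrr addr0 normc_real ger0_norm; last exact: sumr_ge0.
  by lra.
split=> //; split.
  by move=> i; apply: act_ge0 => // j; exact: inL_ge0.
by exists z; rewrite cz cy mat_act_real.
Qed.

(** |A x| <= A |x| and A |x| is in L, so solidity supplies the element that [xget] looks for and its
    default 0 never occurs. *)
Lemma mat_opE A (x : L) : posop A -> c (mat_op A x) = mat_act A (c x).
Proof.
move=> pA; rewrite /mat_op; case: xgetP => [z _ ->//|] /= h.
have [xL _] := inL_abs x.
have [y cy _] := inL_repr (posop_inL pA xL).
have [i|z [cz _]] := @bss_solid_normc (mat_act A (c x)) y.
  by rewrite (le_trans (mat_act_le _ _ pA))// cy normc_real ler_norm.
by have := h z; rewrite cz.
Qed.

Lemma mat_opD A (x y : L) : posop A ->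
  mat_op A (x + y) = mat_op A x + mat_op A y.
Proof.
move=> pA; apply: (@bss_inj _ _ L); apply/funext => i.
rewrite bss_coordD !mat_opE//; apply: has_csum_sum.
have -> : (fun j => (A i j)%:C * c (x + y) j) =
    (fun j => (A i j)%:C * c x j + (A i j)%:C * c y j).
  by apply/funext => j; rewrite bss_coordD mulrDr.
by apply: has_csumD; exact: mat_act_has_csum.
Qed.

Lemma mat_opZ A (a : K[i]) (x : L) : posop A ->
  mat_op A (a *: x) = a *: mat_op A x.
Proof.
move=> pA; apply: (@bss_inj _ _ L); apply/funext => i.
rewrite bss_coordZ !mat_opE//; apply: has_csum_sum.
have -> : (fun j => (A i j)%:C * c (a *: x) j) =
    (fun j => a * ((A i j)%:C * c x j)).
  by apply/funext => j; rewrite bss_coordZ mulrCA.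
by apply: has_csumZ; exact: mat_act_has_csum.
Qed.

(* If A were unbounded, some series of nonnegative vectors u_n / 2 ^ n with
   nrm u_n <= 1 and nrm (A u_n) >= 4 ^ n would converge to a vector that A cannot act on. *)
Lemma posop_bounded A : posop A ->
  exists C, 0 <= C /\ forall u, inL u -> nrm (act A u) <= C * nrm u.
Proof.
move=> pA; apply: contrapT => nb.
have U (n : nat) : exists u, [/\ inL u, nrm u <= 1 & 4 ^+ n <= nrm (act A u)].
  apply: contrapT => nu; apply: nb; exists (4 ^+ n); rewrite exprn_ge0//; split=> // u uL.
  have [u0|un0] := eqVneq (nrm u) 0.
    suff -> : act A u = fun=> 0.
      have [] := inLZ (lexx 0) uL; under eq_fun do rewrite mul0r.
      by move=> _ ->; rewrite mul0r mulr_ge0 ?exprn_ge0 ?nrm_ge0.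
    apply/funext => i; have [] := @nsum1 K I (fun j => A i j * u j) i.
    - by rewrite mulr_ge0 ?(posop_ge0 _ _ pA) ?(inL_ge0 _ uL).
    - move=> j _; suff -> : u j = 0 by rewrite mulr0.
      by apply/eqP; rewrite eq_le (inL_ge0 _ uL)// andbT -u0 inL_coord_le.
    - move=> _; rewrite /act => ->; suff -> : u i = 0 by rewrite mulr0.
      by apply/eqP; rewrite eq_le (inL_ge0 _ uL)// andbT -u0 inL_coord_le.
  have ugt0 : 0 < nrm u by rewrite lt_def un0 nrm_ge0.
  have ui0 : 0 <= (nrm u)^-1 by rewrite invr_ge0 ltW.
  have [vL nv] := inLZ ui0 uL.
  apply: contrapT => /negP; rewrite -ltNge => lt; apply: nu.
  exists (fun i => (nrm u)^-1 * u i); split=> //; first by rewrite nv mulVf.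
  have -> : act A (fun i => (nrm u)^-1 * u i) = fun i => (nrm u)^-1 * act A u i.
    apply/funext => i; rewrite /act -(nsumZ ui0 (posop_summ i pA uL)).2.
    by congr nsum; apply/funext => j; rewrite mulrCA.
  have [_ ->] := inLZ ui0 (posop_inL pA uL).
  by rewrite mulrC ler_pdivlMr// ltW.
have [u hu] := choice U.
have uL n : inL (u n) by have [] := hu n.
have /choice[x hx] : forall n, exists y : L, c y = of_real (u n) by move=> n; case: (uL n).
have xn n : rnorm (x n) <= 1 by rewrite -(nrm_eq (hx n)); have [] := hu n.
pose h : K := 2^-1.
have h01 : 0 <= h < 1 by rewrite /h; lra.
have h0 : 0 <= h by case/andP: h01.
have [n|y yM] := @geometric_series_cvg K L (fun n => (h ^+ n)%:C *: x n) 1 h h01 ler01.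
  by rewrite rnormZ normc_real ger0_norm ?exprn_ge0// mul1r ler_piMr ?exprn_ge0.
(* The partial sums past n dominate the n-th term and converge to y in each coordinate, because
   coordinates are bounded by the norm. *)
have yu n i : h ^+ n * u n i <= normc (c y i).
  apply/ler_addgt0Pr => e e0.
  have [M0 hM0] := geometric_lt (1 / (1 - h)) h01 e0.
  pose M := (M0 + n.+1)%N.
  have hM : 1 / (1 - h) * h ^+ M < e.
    apply: le_lt_trans hM0; rewrite ler_wpM2l//.
      by rewrite /h; have -> : 1 / (1 - 2^-1) = 2 :> K by field.
    by rewrite exprD ler_piMr ?exprn_ge0// exprn_ile1// ltW//; case/andP: h01.
  have := bss_coord_le (y - \sum_(0 <= k < M) (h ^+ k)%:C *: x k) i.
  rewrite bss_coordB bss_coord_sum.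
  have -> : \sum_(0 <= k < M) c ((h ^+ k)%:C *: x k) i = (\sum_(0 <= k < M) h ^+ k * u k i)%:C.
    by rewrite rmorph_sum; apply: eq_bigr => k _; rewrite bss_coordZ hx rmorphM.
  have hu0 k : 0 <= h ^+ k * u k i by rewrite mulr_ge0 ?exprn_ge0 ?(inL_ge0 _ (uL k)).
  have le : h ^+ n * u n i <= \sum_(0 <= k < M) h ^+ k * u k i.
    rewrite (big_cat_nat (leq0n n) _)/=; last by rewrite ltnW// ltn_addl.
    rewrite (@big_ltn _ _ _ n M)/= ?ltn_addl//.
    by rewrite addrCA lerDl addr_ge0// sumr_ge0.
  have := yM M.
  have := le_normcD (c y i) (- (c y i - (\sum_(0 <= k < M) h ^+ k * u k i)%:C)).
  rewrite normcN opprB addrCA subrr addr0 normc_real.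
  by have := ler_norm (\sum_(0 <= k < M) h ^+ k * u k i); lra.
have [yL _] := inL_abs y.
(* From h^n u_n <= |y| follows h^n A u_n <= A |y|, so the norm of A |y| is at least 4^n / 2^n for
   every n. *)
have big n : 2 ^+ n <= nrm (act A (fun i => normc (c y i))).
  have [_ _ le4] := hu n.
  have hn0 : 0 <= h ^+ n by rewrite exprn_ge0.
  have [] // := @inL_le (fun i => h ^+ n * act A (u n) i) _ (posop_inL pA yL).
    move=> i; rewrite mulr_ge0 ?act_ge0//; last 2 first.
    - by case: pA.
    - by move=> j; exact: inL_ge0.
    rewrite /act -(nsumZ hn0 (posop_summ i pA (uL n))).2/=.
    apply: (le_nsum _ (posop_summ i pA yL)).2 => j.
    have Aij := posop_ge0 i j pA.
    by rewrite !mulr_ge0 ?(inL_ge0 _ (uL n))//= mulrCA ler_wpM2l.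
  move=> _; rewrite (inLZ hn0 (posop_inL pA (uL n))).2; apply: le_trans.
  have -> : 2 ^+ n = h ^+ n * 4 ^+ n :> K by rewrite -exprMn; congr (_ ^+ n); rewrite /h; lra.
  by rewrite ler_wpM2l.
set B := nrm _ in big.
have B0 : 0 < B by rewrite (lt_le_trans _ (big 0%N))// expr0.
have [n] := geometric_lt B h01 ltr01.
rewrite -[X in X < _]mulrC /h exprVn mulrC ltr_pdivrMr ?exprn_gt0// mul1r.
by rewrite ltNge big.
Qed.

(** |A x| <= A |x| and the equality of the norms of x and |x| reduce the complex unit ball to
    non-negative vectors; [posop_bounded] makes the supremum finite. *)
Lemma mat_normP A : posop A ->
  [/\ 0 <= mat_norm L A,
    forall u, inL u -> nrm (act A u) <= mat_norm L A * nrm u &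
    forall C, 0 <= C -> (forall u, inL u -> nrm (act A u) <= C * nrm u) ->
      mat_norm L A <= C].
Proof.
move=> pA.
have opb C (x : L) : 0 <= C -> (forall u, inL u -> nrm (act A u) <= C * nrm u) ->
    rnorm (mat_op A x) <= C * rnorm x.
  move=> C0 hAC; have [xL <-] := inL_abs x; apply: le_trans (hAC _ xL).
  have [y cy <-] := inL_repr (posop_inL pA xL).
  have [i|z [cz]] := @bss_solid_normc (c (mat_op A x)) y.
    by rewrite mat_opE// cy (le_trans (mat_act_le _ _ pA))// normc_real ler_norm.
  by rewrite (bss_inj cz).
have opn C : 0 <= C -> (forall u, inL u -> nrm (act A u) <= C * nrm u) ->
    ubound [set rnorm (mat_op A x) | x in [set x : L | `|x| <= 1]] C.
  move=> C0 hAC _ [x /= x1 <-]; rewrite (le_trans (opb _ _ C0 hAC))//.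
  by rewrite ler_piMr//; move: x1; rewrite rnormE lecR.
have [C [C0 hAC]] := posop_bounded pA.
split=> [|u uL|{}C {}C0 {}hAC].
- apply: (le_trans (rnorm_ge0 (mat_op A (0 : L)))); apply: ub_le_sup.
    by exists C; exact: opn.
  by exists 0 => //=; rewrite normr0.
- have [y cy yu] := inL_repr uL.
  have actE : c (mat_op A y) = of_real (act A u).
    by rewrite mat_opE// cy mat_act_real// => [|i]; [case: pA|exact: posop_summ].
  rewrite (nrm_eq actE) -yu.
  have [y0|yn0] := eqVneq (rnorm y) 0.
    by rewrite (le_trans (opb _ y C0 hAC))// y0 !mulr0.
  have ygt0 : 0 < rnorm y by rewrite lt_def yn0 rnorm_ge0.
  rewrite -ler_pdivrMr//; apply: ub_le_sup; first by exists C; exact: opn.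
  have yi0 : 0 <= (rnorm y)^-1 by rewrite invr_ge0 ltW.
  exists ((rnorm y)^-1%:C *: y) => /=.
    by rewrite rnormE rnormZ normc_real ger0_norm// mulVf.
  by rewrite mat_opZ// rnormZ normc_real ger0_norm// mulrC.
- apply: ge_sup; last exact: opn.
  by exists (rnorm (mat_op A (0 : L))); exists 0 => //=; rewrite normr0.
Qed.

Lemma rnorm_mat_op_le A (x : L) : posop A ->
  rnorm (mat_op A x) <= mat_norm L A * rnorm x.
Proof.
move=> pA; have [_ h _] := mat_normP pA.
have [xL <-] := inL_abs x; apply: le_trans (h _ xL).
have [y cy <-] := inL_repr (posop_inL pA xL).
have [i|z [cz]] := @bss_solid_normc (c (mat_op A x)) y.
  by rewrite mat_opE// cy (le_trans (mat_act_le _ _ pA))// normc_real ler_norm.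
by rewrite (bss_inj cz).
Qed.

End Lattice.

(** * Products and Hadamard means of nonnegative operators *)

Section MatrixProducts.
Variables (K : realType) (I : choiceType) (L : banach_seq_space K I).
Hypothesis hL : normalized L.
Implicit Types (u v : I -> K) (A B C : I -> I -> K).
Local Notation posop := (posop L).
Local Notation inL := (inL L).
Local Notation nrm := (nrm L).

Lemma mat_norm_ge0 A : posop A -> 0 <= mat_norm L A.
Proof. by move=> /(mat_normP hL)[]. Qed.

Lemma nrm_act_le A u : posop A -> inL u -> nrm (act A u) <= mat_norm L A * nrm u.
Proof. by move=> /(mat_normP hL)[_ h _]; exact: h. Qed.

Lemma mat_norm_min A (r : K) : posop A -> 0 <= r ->
  (forall u, inL u -> nrm (act A u) <= r * nrm u) -> mat_norm L A <= r.
Proof. by move=> /(mat_normP hL)[_ _ h]; exact: h. Qed.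

Lemma act_delta A j : nonneg_mat A ->
  (forall i, summ (fun k => A i k * (k == j)%:R)) /\
  act A (fun k => (k == j)%:R) = A^~ j.
Proof.
move=> A0.
have h i : summ (fun k => A i k * (k == j)%:R) /\
    nsum (fun k => A i k * (k == j)%:R) = A i j.
  have [] := @nsum1 K I (fun k => A i k * (k == j)%:R) j.
  - by rewrite mulr_ge0// ler0n.
  - by move=> k /negPf->; rewrite mulr0.
  - by rewrite eqxx mulr1.
split=> [i|]; first by case: (h i).
by apply/funext => i; case: (h i).
Qed.

(** Every e_j lies in L and A e_j is the j-th column. Associativity and the unit laws of [mat_mul]
    are thus read off the action on vectors. *)
Lemma posop_ext A B : nonneg_mat A -> nonneg_mat B ->
  (forall u, inL u -> act A u = act B u) -> A = B.
Proof.
move=> A0 B0 h; apply/funext => i; apply/funext => j.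
have [_ eA] := act_delta j A0; have [_ eB] := act_delta j B0.
by have := h _ (inL_delta hL j).1; rewrite eA eB => /(congr1 (@^~ i)).
Qed.

(** The entry is the i-th coordinate of A e_j, and e_j has norm 1. This is the pointwise bound with
    constant 1, so no factor appears in the norm inequalities when m a > 1. *)
Lemma entry_le_mat_norm A i j : posop A -> A i j <= mat_norm L A.
Proof.
move=> pA; have [dL d1] := inL_delta hL j.
have := nrm_act_le pA dL; rewrite d1 mulr1; apply: le_trans.
have := inL_coord_le hL i (posop_inL pA dL).
by rewrite (act_delta j (proj1 pA)).2.
Qed.

(** Column j of B is B e_j, an element of L on which A acts; the entries of [mat_mul] are therefore
    genuine sums. *)
Lemma summ_mat_mul A B i j : posop A -> posop B -> summ (fun k => A i k * B k j).
Proof.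
move=> pA pB; have [dL _] := inL_delta hL j.
by have := posop_summ i pA (posop_inL pB dL); rewrite (act_delta j (proj1 pB)).2.
Qed.

Lemma act_mat_mul A B u : posop A -> posop B -> inL u ->
  (forall i, summ (fun j => mat_mul A B i j * u j)) /\
  act (mat_mul A B) u = act A (act B u).
Proof.
move=> pA pB uL.
suff h i : summ (fun j => mat_mul A B i j * u j) /\
    nsum (fun j => mat_mul A B i j * u j) = nsum (fun k => A i k * act B u k).
  by split=> [i|]; [case: (h i)|apply/funext => i; case: (h i)].
pose f k j := A i k * (B k j * u j).
have f0 k j : 0 <= f k j.
  by rewrite !mulr_ge0// ?(inL_ge0 _ uL)//; [case: pA|case: pB].
have fk k := nsumZ (posop_ge0 i k pA) (posop_summ k pB uL).
have [] := @nsum_exchange K I I f f0.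
- by move=> k; case: (fk k).
- rewrite (_ : (fun k => nsum (f k)) = (fun k => A i k * act B u k)).
    by apply: (posop_summ i pA); exact: posop_inL.
  by apply/funext => k; case: (fk k).
have -> : (fun j => nsum (f^~ j)) = (fun j => mat_mul A B i j * u j).
  apply/funext => j; rewrite mulrC.
  rewrite -(nsumZ (inL_ge0 j uL) (summ_mat_mul i j pA pB)).2.
  by congr nsum; apply/funext => k; rewrite /f; ring.
have -> // : (fun k => nsum (f k)) = (fun k => A i k * act B u k).
by apply/funext => k; case: (fk k).
Qed.

Lemma nonneg_mat_mul A B : nonneg_mat A -> nonneg_mat B -> nonneg_mat (mat_mul A B).
Proof. by move=> A0 B0 i j; apply: nsum_ge0 => k; rewrite mulr_ge0. Qed.

Lemma posop_mat_mul A B : posop A -> posop B -> posop (mat_mul A B).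
Proof.
move=> pA pB; split; first by apply: nonneg_mat_mul; [case: pA|case: pB].
move=> u uL; have [su ->] := act_mat_mul pA pB uL; split=> //.
by apply: posop_inL => //; exact: posop_inL.
Qed.

Lemma mat_mul_act A B u : posop A -> posop B -> inL u ->
  act (mat_mul A B) u = act A (act B u).
Proof. by move=> pA pB /(act_mat_mul pA pB)[]. Qed.

Lemma nonneg_mat_one : nonneg_mat (@mat_one K I).
Proof. by move=> i j; rewrite /mat_one ler0n. Qed.

Lemma act_one u : (forall i, 0 <= u i) ->
  (forall i, summ (fun j => @mat_one K I i j * u j)) /\ act (@mat_one K I) u = u.
Proof.
move=> u0; have h i : summ (fun j => @mat_one K I i j * u j) /\
    nsum (fun j => @mat_one K I i j * u j) = u i.
  have [] := @nsum1 K I (fun j => @mat_one K I i j * u j) i.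
  - by rewrite mulr_ge0// ler0n.
  - by move=> j; rewrite eq_sym /mat_one => /negPf->; rewrite mul0r.
  - by rewrite /mat_one eqxx mul1r.
by split=> [i|]; [case: (h i)|apply/funext => i; case: (h i)].
Qed.

Lemma posop_one : posop (@mat_one K I).
Proof.
split; first exact: nonneg_mat_one.
by move=> u uL; have [su ->] := act_one (fun i => inL_ge0 i uL).
Qed.

Lemma mat_mulA A B C : posop A -> posop B -> posop C ->
  mat_mul A (mat_mul B C) = mat_mul (mat_mul A B) C.
Proof.
move=> pA pB pC.
have pAB := posop_mat_mul pA pB; have pBC := posop_mat_mul pB pC.
apply: posop_ext => [||u uL].
- by case: (posop_mat_mul pA pBC).
- by case: (posop_mat_mul pAB pC).
- by rewrite !mat_mul_act//; exact: posop_inL.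
Qed.

Lemma mat_mul1l A : posop A -> mat_mul (@mat_one K I) A = A.
Proof.
move=> pA; have p1 := posop_one; have [A0 _] := pA.
apply: posop_ext => [||u uL] //; first by case: (posop_mat_mul p1 pA).
rewrite mat_mul_act// (act_one _).2// => i.
exact: (inL_ge0 i (posop_inL pA uL)).
Qed.

Lemma mat_mul1r A : posop A -> mat_mul A (@mat_one K I) = A.
Proof.
move=> pA; have p1 := posop_one; have [A0 _] := pA.
apply: posop_ext => [||u uL] //; first by case: (posop_mat_mul pA p1).
by rewrite mat_mul_act// (act_one _).2// => i; exact: (inL_ge0 i uL).
Qed.

Lemma posop_prod (J : Type) (s : seq J) (F : J -> I -> I -> K) :
  (forall j, posop (F j)) -> posop (\big[@mat_mul K I/@mat_one K I]_(j <- s) F j).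
Proof.
move=> pF; elim: s => [|j s IH]; first by rewrite big_nil; exact: posop_one.
by rewrite big_cons; exact: posop_mat_mul.
Qed.

Lemma mat_prod_cat (J : Type) (s1 s2 : seq J) (F : J -> I -> I -> K) :
  (forall j, posop (F j)) ->
  \big[@mat_mul K I/@mat_one K I]_(j <- s1 ++ s2) F j =
  mat_mul (\big[@mat_mul K I/@mat_one K I]_(j <- s1) F j)
          (\big[@mat_mul K I/@mat_one K I]_(j <- s2) F j).
Proof.
move=> pF; elim: s1 => [|j s1 IH]; first by rewrite big_nil mat_mul1l//; exact: posop_prod.
by rewrite /= !big_cons IH mat_mulA//; exact: posop_prod.
Qed.

Lemma mat_norm_le A B : posop B -> (forall i j, 0 <= A i j <= B i j) ->
  mat_norm L A <= mat_norm L B.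
Proof.
move=> pB AB; have pA := posop_le pB AB.
apply: mat_norm_min => //; first exact: mat_norm_ge0.
move=> u uL; apply: le_trans (nrm_act_le pB uL).
have [] // := @inL_le K I L (act A u) (act B u) (posop_inL pB uL) => i.
rewrite act_ge0//=; last 2 first.
- by case: pA.
- by move=> j; exact: (inL_ge0 j uL).
by apply: (act_le i AB _ pB uL) => j; rewrite (inL_ge0 j uL)/=.
Qed.

Lemma mat_norm_mul A B : posop A -> posop B ->
  mat_norm L (mat_mul A B) <= mat_norm L A * mat_norm L B.
Proof.
move=> pA pB; have pAB := posop_mat_mul pA pB.
apply: mat_norm_min => //; first by rewrite mulr_ge0 ?mat_norm_ge0.
move=> u uL; rewrite mat_mul_act// -mulrA.
rewrite (le_trans (nrm_act_le pA (posop_inL pB uL)))//.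
by rewrite ler_wpM2l ?mat_norm_ge0// nrm_act_le.
Qed.

Lemma mat_norm_one : mat_norm L (@mat_one K I) <= 1.
Proof.
apply: mat_norm_min => //; first exact: posop_one.
by move=> u uL; rewrite (act_one _).2 ?mul1r// => i; exact: (inL_ge0 i uL).
Qed.

Lemma posop0 : posop (fun _ _ => 0) /\
  forall u, act (fun _ _ : I => 0) u = fun=> 0.
Proof.
have h u (i : I) : summ (fun j => 0 * u j) /\ nsum (fun j => 0 * u j) = 0.
  have [] := @nsum1 K I (fun j => 0 * u j) i.
  - by rewrite mul0r.
  - by move=> j _; rewrite mul0r.
  - by rewrite mul0r.
have a0 u : act (fun _ _ : I => 0) u = fun=> 0.
  by apply/funext => i; case: (h u i).
split=> //; split=> // u uL; split=> [i|]; first by case: (h u i).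
by rewrite a0; have [] := inLZ (lexx 0) uL; under eq_fun do rewrite mul0r.
Qed.

Lemma posopD A B : posop A -> posop B -> posop (fun i j => A i j + B i j) /\
  forall u, inL u -> act (fun i j => A i j + B i j) u = fun i => act A u i + act B u i.
Proof.
move=> pA pB.
have h u (uL : inL u) i : summ (fun j => (A i j + B i j) * u j) /\
    nsum (fun j => (A i j + B i j) * u j) = act A u i + act B u i.
  have -> : (fun j => (A i j + B i j) * u j) = (fun j => A i j * u j + B i j * u j).
    by apply/funext => j; rewrite mulrDl.
  exact: nsumD (posop_summ i pA uL) (posop_summ i pB uL).
have aD u : inL u ->
    act (fun i j => A i j + B i j) u = fun i => act A u i + act B u i.
  by move=> uL; apply/funext => i; case: (h u uL i).
split=> //; split=> [i j|u uL].
  by rewrite addr_ge0//; [case: pA|case: pB].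
split=> [i|]; first by case: (h u uL i).
by rewrite aD//; have [] := inLD (posop_inL pA uL) (posop_inL pB uL).
Qed.

Lemma posopZ A (r : K) : 0 <= r -> posop A -> posop (fun i j => r * A i j) /\
  forall u, inL u -> act (fun i j => r * A i j) u = fun i => r * act A u i.
Proof.
move=> r0 pA.
have h u (uL : inL u) i : summ (fun j => (r * A i j) * u j) /\
    nsum (fun j => (r * A i j) * u j) = r * act A u i.
  have -> : (fun j => (r * A i j) * u j) = (fun j => r * (A i j * u j)).
    by apply/funext => j; rewrite mulrA.
  exact: nsumZ r0 (posop_summ i pA uL).
have aZ u : inL u -> act (fun i j => r * A i j) u = fun i => r * act A u i.
  by move=> uL; apply/funext => i; case: (h u uL i).
split=> //; split=> [i j|u uL]; first by rewrite mulr_ge0//; case: pA.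
split=> [i|]; first by case: (h u uL i).
by rewrite aZ//; have [] := inLZ r0 (posop_inL pA uL).
Qed.

Lemma mat_norm_sublinear : monotone_sublinear 1
  (fun f : I * I -> K => posop (fun i j => f (i, j)))
  (fun f => mat_norm L (fun i j => f (i, j))).
Proof.
split=> [f [i j] [f0 _]|f|f [i j] pf|f g pg fg||f g pf pg|r f r0 pf].
- exact: f0.
- exact: mat_norm_ge0.
- by rewrite mul1r; exact: (@entry_le_mat_norm (fun i j => f (i, j))).
- split; first by apply: (posop_le pg) => i j; exact: fg.
  by apply: mat_norm_le => // i j; exact: fg.
- have [p0 a0] := posop0; split=> //; apply: mat_norm_min => // u uL.
  rewrite a0 mul0r; have [_] := inLZ (lexx 0) uL.
  by under eq_fun do rewrite mul0r; rewrite mul0r => ->.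
- have [pD aD] := posopD pf pg; split=> //.
  apply: mat_norm_min => //; first by rewrite addr_ge0 ?mat_norm_ge0.
  move=> u uL; rewrite aD//.
  rewrite (le_trans (inLD (posop_inL pf uL) (posop_inL pg uL)).2)// mulrDl.
  by rewrite lerD// nrm_act_le.
- have [pZ aZ] := posopZ r0 pf; split=> //.
  apply: mat_norm_min => //; first by rewrite mulr_ge0 ?mat_norm_ge0.
  move=> u uL; rewrite aZ// (inLZ r0 (posop_inL pf uL)).2 -mulrA.
  by rewrite ler_wpM2l// nrm_act_le.
Qed.

Lemma mat_mul_le A B C D i j : posop B -> posop D ->
  (forall i j, 0 <= A i j <= B i j) -> (forall i j, 0 <= C i j <= D i j) ->
  mat_mul A C i j <= mat_mul B D i j.
Proof.
move=> pB pD AB CD.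
have [] // := @le_nsum K I (fun k => A i k * C k j) (fun k => B i k * D k j).
  move=> k; have /andP[a0 ab] := AB i k; have /andP[c0 cd] := CD k j.
  by rewrite mulr_ge0//= ler_pM.
exact: summ_mat_mul.
Qed.

Section Hadamard.
Variables (m : nat) (a : K).
Hypotheses (m_gt0 : (0 < m)%N) (ma : 1 <= m%:R * a).
Local Notation hmean F := (hadamard_prod (fun k : 'I_m => hadamard_pow (F k) a)).

Lemma hadamard_mean_norm (F : 'I_m -> I -> I -> K) : (forall k, posop (F k)) ->
  posop (hmean F) /\ mat_norm L (hmean F) <= \prod_(k < m) mat_norm L (F k) `^ a.
Proof.
move=> pF.
have := @msl_geometric_mean K (I * I) 1 _ _ mat_norm_sublinear m a
  (fun k p => F k p.1 p.2) m_gt0 ma ler01 pF.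
by rewrite powR1 mul1r.
Qed.

(** With i and j fixed this is Hölder's inequality for the inner index, in the form sum_l prod_k
    x_kl^a <= prod_k (sum_l x_kl)^a for m a >= 1. *)
Lemma hadamard_mean_mul (F G : 'I_m -> I -> I -> K) i j :
  (forall k, posop (F k)) -> (forall k, posop (G k)) ->
  mat_mul (hmean F) (hmean G) i j <= hmean (fun k => mat_mul (F k) (G k)) i j.
Proof.
move=> pF pG.
have [_] := @msl_geometric_mean K I 1 _ _ (@nsum_monotone_sublinear K I) m a
  (fun k l => F k i l * G k l j) m_gt0 ma ler01
  (fun k => summ_mat_mul i j (pF k) (pG k)).
rewrite powR1 mul1r; apply: le_trans.
rewrite le_eqVlt; apply/orP; left; apply/eqP; congr nsum; apply/funext => l.
rewrite /hadamard_prod /hadamard_pow -big_split; apply: eq_bigr => k _.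
by rewrite powRM//; [case: (pF k)|case: (pG k)].
Qed.

Lemma nonneg_hmean (F : 'I_m -> I -> I -> K) : nonneg_mat (hmean F).
Proof. by move=> i j; apply: prodr_ge0 => k _; rewrite powR_ge0. Qed.

Lemma hadamard_mean_prod (J : Type) (s : seq J) (F : J -> 'I_m -> I -> I -> K) i j :
  (forall j k, posop (F j k)) ->
  0 <= (\big[@mat_mul K I/@mat_one K I]_(l <- s) hmean (F l)) i j <=
    hmean (fun k => \big[@mat_mul K I/@mat_one K I]_(l <- s) F l k) i j.
Proof.
move=> pF.
have ph l : posop (hmean (F l)) by case: (hadamard_mean_norm (pF l)).
have pp t := posop_prod t ph.
have pq t k : posop (\big[@mat_mul K I/@mat_one K I]_(l <- t) F l k).
  by apply: posop_prod => l.
apply/andP; split; first by case: (pp s) => h _; exact: h.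
elim: s i j => [|l s IH] i j.
  under [in leRHS]eq_fun do rewrite big_nil.
  rewrite big_nil /hadamard_prod /hadamard_pow /mat_one; have [_|ij] := eqVneq i j.
    by under eq_bigr do rewrite powR1; rewrite big1.
  by apply: prodr_ge0 => k _; rewrite powR_ge0.
under [in leRHS]eq_fun do rewrite big_cons.
rewrite big_cons; apply: le_trans (hadamard_mean_mul i j (pF l) (pq s)).
apply: mat_mul_le => //; first by case: (hadamard_mean_norm (pq s)).
  by move=> i' j'; rewrite lexx nonneg_hmean.
by move=> i' j'; rewrite IH andbT; case: (pp s) => h _; exact: h.
Qed.

End Hadamard.
End MatrixProducts.

(** * The spectral radius as the growth rate of powers *)

Section SpectralRadius.
Variables (K : realType) (I : choiceType) (L : banach_seq_space K I).
Hypothesis hL : normalized L.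
Implicit Types (u v : I -> K) (A B : I -> I -> K).
Local Notation posop := (posop L).
Local Notation inL := (inL L).
Local Notation nrm := (nrm L).
Local Notation c := (bss_coord L).

Lemma mat_expE A n : mat_exp A n = iter n (mat_mul A) (@mat_one K I).
Proof. by rewrite /mat_exp big_const_ord. Qed.

Lemma mat_expS A n : mat_exp A n.+1 = mat_mul A (mat_exp A n).
Proof. by rewrite !mat_expE. Qed.

Lemma posop_exp A n : posop A -> posop (mat_exp A n).
Proof. by move=> pA; apply: posop_prod. Qed.

Lemma mat_expD A n k : posop A ->
  mat_exp A (n + k) = mat_mul (mat_exp A n) (mat_exp A k).
Proof.
move=> pA; elim: n => [|n IH].
  by rewrite add0n [mat_exp A 0]mat_expE/= (mat_mul1l hL)//; exact: posop_exp.
by rewrite addSn !mat_expS IH (mat_mulA hL)//; exact: posop_exp.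
Qed.

Lemma mat_expM A n k : posop A -> mat_exp A (n * k) = mat_exp (mat_exp A n) k.
Proof.
move=> pA; elim: k => [|k IH]; first by rewrite muln0 !mat_expE.
by rewrite mulnS mat_expD// IH mat_expS.
Qed.

Lemma act_exp A n u : posop A -> inL u -> act (mat_exp A n) u = iter n (act A) u.
Proof.
move=> pA uL; elim: n => [|n IH].
  by rewrite mat_expE/= (act_one _).2// => i; exact: (inL_ge0 i uL).
by rewrite mat_expS (mat_mul_act hL)//= ?IH//; exact: posop_exp.
Qed.

Lemma mat_exp_le A B n i j : posop B -> (forall i j, 0 <= A i j <= B i j) ->
  0 <= mat_exp A n i j <= mat_exp B n i j.
Proof.
move=> pB AB; have pA := posop_le pB AB.
elim: n i j => [|n IH] i j; first by rewrite !mat_expE/= lexx nonneg_mat_one.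
rewrite (proj1 (posop_exp n.+1 pA))/= !mat_expS.
by apply: (mat_mul_le hL) => //; exact: posop_exp.
Qed.

Local Notation p A n := (mat_norm L (mat_exp A n)).

Lemma norm_exp_ge0 A n : posop A -> 0 <= p A n.
Proof. by move=> pA; apply: mat_norm_ge0 => //; exact: posop_exp. Qed.

Lemma norm_expD A n k : posop A -> p A (n + k) <= p A n * p A k.
Proof.
by move=> pA; rewrite mat_expD//; apply: mat_norm_mul => //; exact: posop_exp.
Qed.

(** The constant C absorbs every factor independent of n, such as those lost on passing from A B to
    B A or to a subsequence of powers. *)
Definition growth A (s : K) : Prop :=
  exists C, 0 <= C /\ forall n, p A n <= C * s ^+ n.

Lemma growth_subseq A (s C : K) N : posop A -> (0 < N)%N -> 0 < s -> 0 <= C ->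
  (forall q, p A (N * q) <= C * s ^+ (N * q)) -> growth A s.
Proof.
move=> pA N0 s0 C0 h.
(* For n = N q + k with k < N, the cost p A k / s^k of the remainder is one term of this sum. *)
exists (C * \sum_(k < N) p A k / s ^+ k); split=> [|n].
  rewrite mulr_ge0// sumr_ge0// => k _.
  by rewrite divr_ge0 ?norm_exp_ge0// exprn_ge0// ltW.
rewrite {1}(divn_eq n N) mulnC (le_trans (norm_expD _ _ pA))//.
apply: (@le_trans _ _ (C * s ^+ (N * (n %/ N)) * p A (n %% N))).
  by rewrite ler_wpM2r// norm_exp_ge0.
have -> : s ^+ n = s ^+ (N * (n %/ N)) * s ^+ (n %% N).
  by rewrite -exprD {1}(divn_eq n N) mulnC.
rewrite -!mulrA ler_wpM2l// mulrCA ler_wpM2l ?exprn_ge0 ?(ltW s0)//.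
rewrite -ler_pdivrMr ?exprn_gt0//.
rewrite (bigD1 (Ordinal (ltn_pmod n N0)))//= lerDl sumr_ge0// => k _.
by rewrite divr_ge0 ?norm_exp_ge0// exprn_ge0// ltW.
Qed.

Lemma growth_of_exp A (s : K) N : posop A -> (0 < N)%N -> 0 < s ->
  p A N <= s ^+ N -> growth A s.
Proof.
move=> pA N0 s0 h; apply: (@growth_subseq A s 1 N) => // q; rewrite mul1r.
elim: q => [|q IH].
  by rewrite muln0 expr0 mat_expE/=; exact: mat_norm_one.
rewrite mulnS exprD (le_trans (norm_expD _ _ pA))// ler_pM ?norm_exp_ge0//.
Qed.

Lemma growth_le A (s t : K) : 0 < s <= t -> growth A s -> growth A t.
Proof.
move=> /andP[s0 st] [C [C0 h]]; exists C; split=> // n.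
by rewrite (le_trans (h n))// ler_wpM2l// lerXn2r// nnegrE ltW// (lt_le_trans s0).
Qed.

(** The added 1 keeps the rate positive when A has norm 0. *)
Lemma growth_norm A : posop A -> growth A (mat_norm L A + 1).
Proof.
move=> pA; have n0 := mat_norm_ge0 hL pA.
apply: (@growth_of_exp A _ 1) => //; first by rewrite ltr_wpDl.
by rewrite expr1 mat_expS mat_expE/= (mat_mul1r hL)// lerDl.
Qed.

Section Operator.
Variable A : I -> I -> K.
Hypothesis pA : posop A.
Let f : L -> L := @mat_op K I L A.

Lemma mat_op_iter_le n x i :
  normc (c (iter n f x) i) <= act (mat_exp A n) (fun j => normc (c x j)) i.
Proof.
have [xL _] := inL_abs x; rewrite act_exp//.
elim: n i => [|n IH] i //=.
rewrite {1}/f mat_opE// (le_trans (mat_act_le _ _ pA))//.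
apply: (@act_le _ _ L) => //.
- by move=> i' j'; rewrite lexx (proj1 pA).
- by move=> j; rewrite normc_ge0 IH.
- by rewrite -act_exp//; apply: posop_inL => //; exact: posop_exp.
Qed.

Lemma rnorm_mat_op_iter n x : rnorm (iter n f x) <= p A n * rnorm x.
Proof.
have [xL <-] := inL_abs x; have pn := posop_exp n pA.
apply: (le_trans _ (nrm_act_le hL pn xL)).
have [_ <-] := inL_abs (iter n f x).
apply: (inL_le (posop_inL pn xL) _).2 => i.
by rewrite normc_ge0 mat_op_iter_le.
Qed.

Lemma mat_opB x y : f (x - y) = f x - f y.
Proof. by rewrite /f mat_opD// -scaleN1r mat_opZ// scaleN1r. Qed.

Lemma mat_op0 : f 0 = 0.
Proof. by have := mat_opB 0 0; rewrite !subrr. Qed.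

Definition neumann (z : K[i]) (x : L) (M : nat) : L :=
  \sum_(0 <= n < M) z ^- n.+1 *: iter n f x.

Lemma neumann_telescope z x M : z != 0 ->
  z *: neumann z x M - f (neumann z x M) = x - z ^- M *: iter M f x.
Proof.
move=> z0; rewrite /neumann; elim: M => [|M IH].
  by rewrite big_geq// mat_op0 scaler0 expr0 invr1 scale1r !subrr.
rewrite big_nat_recr//= /f mat_opD// mat_opZ// -/f scalerDr opprD addrACA IH.
rewrite scalerA exprS invfM mulrA mulfV// mul1r.
by rewrite addrA subrK.
Qed.

Lemma growth_lt1 (s : K) (z : K[i]) : 0 < s -> s < normc z ->
  [/\ z != 0, 0 < normc z & 0 <= s / normc z < 1].
Proof.
move=> s0 sz; have z0 : 0 < normc z by rewrite (lt_trans s0).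
split=> //; first by apply: contraTneq z0 => ->; rewrite normc0 ltxx.
by rewrite divr_ge0 ?(ltW s0) ?(ltW z0)//= ltr_pdivrMr// mul1r.
Qed.

Lemma normcX (z : K[i]) n : normc (z ^+ n) = normc z ^+ n.
Proof.
elim: n => [|n IH]; first by rewrite !expr0 normc1.
by rewrite !exprS normcM IH.
Qed.

Lemma rnorm_scaled_iter (s C : K) z x n : 0 < s -> s < normc z ->
  p A n <= C * s ^+ n ->
  rnorm (z ^- n *: iter n f x) <= C * rnorm x * (s / normc z) ^+ n.
Proof.
move=> s0 sz h; have [_ z0 _] := growth_lt1 s0 sz.
rewrite rnormZ normcV normcX exprMn exprVn.
have zn0 : 0 <= (normc z ^+ n)^-1 by rewrite invr_ge0 exprn_ge0// ltW.
apply: (le_trans (ler_wpM2l zn0 (rnorm_mat_op_iter n x))).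
have -> : C * rnorm x * (s ^+ n / normc z ^+ n) =
  (normc z ^+ n)^-1 * (C * s ^+ n * rnorm x) by ring.
by rewrite ler_wpM2l// ler_wpM2r// rnorm_ge0.
Qed.

Lemma neumann_inverse (s : K) z : 0 < s -> growth A s -> s < normc z ->
  exists D, 0 <= D /\ forall x, exists y, z *: y - f y = x /\ rnorm y <= D * rnorm x.
Proof.
move=> s0 [C [C0 h]] sz; have [z0 nz0 q01] := growth_lt1 s0 sz.
set q := s / normc z in q01.
have /andP[q0 q1] := q01; have q10 : 0 < 1 - q by rewrite subr_gt0.
pose D := (normc z)^-1 * C / (1 - q).
have D0 : 0 <= D by rewrite /D !mulr_ge0// invr_ge0 ltW.
exists D; split=> // x.
have C'0 : 0 <= (normc z)^-1 * (C * rnorm x).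
  by rewrite !mulr_ge0// ?rnorm_ge0// invr_ge0 ltW.
have [n|y yM] := @geometric_series_cvg K L (fun n => z ^- n.+1 *: iter n f x)
   ((normc z)^-1 * (C * rnorm x)) q q01 C'0.
  rewrite exprS invfM -scalerA rnormZ normcV -mulrA ler_wpM2l ?invr_ge0 ?(ltW nz0)//.
  exact: rnorm_scaled_iter.
exists y; split; last first.
  have := yM 0%N; rewrite big_geq// subr0 expr0 mulr1 /D.
  by have -> : (normc z)^-1 * (C * rnorm x) / (1 - q) = (normc z)^-1 * C / (1 - q) * rnorm x
    by ring.
apply/eqP; rewrite -subr_eq0; apply/eqP/rnorm_eq0/eqP.
rewrite eq_le rnorm_ge0 andbT; apply/ler_addgt0Pr => e e0; rewrite add0r.
(* For every M the defect z y - A y - x is at most E q^M: the first summand of E bounds z - A on the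
   tail of the series, the second bounds the term z^-M A^M x left by telescoping. *)
pose E := (normc z + mat_norm L A) * ((normc z)^-1 * (C * rnorm x) / (1 - q)) + C * rnorm x.
have [M hM] := geometric_lt E q01 e0.
apply: (le_trans _ (ltW hM)).
have -> : z *: y - f y - x =
    z *: (y - neumann z x M) - f (y - neumann z x M) - z ^- M *: iter M f x.
  rewrite mat_opB scalerBr opprD opprK addrACA.
  have -> : - (z *: neumann z x M) + f (neumann z x M) = z ^- M *: iter M f x - x.
    by rewrite addrC -opprB neumann_telescope// opprB.
  by rewrite -[RHS]addrA [X in _ = _ + X]addrAC subrr add0r.
have t1 := ler_rnormD (z *: (y - neumann z x M) - f (y - neumann z x M))
  (- (z ^- M *: iter M f x)).
have t2 := ler_rnormD (z *: (y - neumann z x M)) (- f (y - neumann z x M)).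
rewrite rnormN in t1; rewrite rnormN rnormZ in t2.
have t3 := rnorm_mat_op_le hL (y - neumann z x M) pA.
have t4 := rnorm_scaled_iter x s0 sz (h M).
have t5 := yM M; rewrite -/(neumann z x M) in t5.
have n0 := mat_norm_ge0 hL pA.
have t6 := ler_wpM2l (addr_ge0 (ltW nz0) n0) t5.
rewrite /E mulrDl -!mulrA -/q in t4 t6 *.
rewrite -/f in t3.
rewrite mulrDl in t6.
lra.
Qed.

(** A solution satisfies x = z^-n A^n x for every n, and the right-hand side tends to 0. *)
Lemma resolvent_inj (s : K) z x : 0 < s -> growth A s -> s < normc z ->
  z *: x - f x = 0 -> x = 0.
Proof.
move=> s0 [C [C0 h]] sz /eqP; rewrite subr_eq0 => /eqP zx.
have [z0 nz0 q01] := growth_lt1 s0 sz.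
have it n : z ^- n *: iter n f x = x.
  elim: n => [|n IH]; first by rewrite expr0 invr1 scale1r.
  rewrite iterSr -zx.
  have itZ k w (a : K[i]) : iter k f (a *: w) = a *: iter k f w.
    by elim: k => //= k ->; rewrite /f mat_opZ.
  by rewrite itZ scalerA exprSr invfM divfK// IH.
apply/rnorm_eq0/eqP; rewrite eq_le rnorm_ge0 andbT.
apply/ler_addgt0Pr => e e0; rewrite add0r.
have [M hM] := geometric_lt (C * rnorm x) q01 e0.
by rewrite -(it M) (le_trans (rnorm_scaled_iter x s0 sz (h M)))// ltW.
Qed.

Lemma not_spectrum_growth (s : K) z : 0 < s -> growth A s -> s < normc z ->
  ~ spectrum f z.
Proof.
move=> s0 gs sz; apply => /=.
have [D [D0 hD]] := neumann_inverse s0 gs sz.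
have [g hg] := choice hD.
have inj x y : z *: x - f x = z *: y - f y -> x = y.
  move=> e; apply/eqP; rewrite -subr_eq0; apply/eqP.
  apply: (resolvent_inj s0 gs sz); rewrite scalerBr mat_opB.
  by rewrite opprD opprK addrACA e [X in _ + X]addrC addrA subrK subrr.
(* Choice yields only some solution map g; uniqueness of solutions makes it linear. *)
have glin : linear g.
  move=> a x y; apply: inj; rewrite (hg _).1.
  rewrite /f mat_opD// mat_opZ// -/f scalerDr opprD addrACA (hg y).1.
  by rewrite scalerA mulrC -scalerA -scalerBr (hg x).1.
pose gl : {linear L -> L} :=
  HB.pack_for {linear L -> L} g (GRing.isLinear.Build K[i] L L *:%R g glin).
exists gl; split=> [x|x|x] /=.
- apply/cvgrPdist_lt => e; rewrite ltcE => /andP[/= /eqP ei er].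
  have {ei}-> : e = (complex.Re e)%:C by case: e ei {er} => a b /= ->.
  have D1 : 0 < D + 1 by rewrite ltr_wpDl.
  have d0 : (0 : K[i]) < (complex.Re e / (D + 1))%:C by rewrite ltcR divr_gt0.
  near=> y.
  have -> : g x - g y = g (x - y).
    by have := glin (-1) y x; rewrite !scaleN1r ![- _ + _]addrC => ->.
  rewrite rnormE ltcR (le_lt_trans (hg _).2)//.
  have : `|x - y| < (complex.Re e / (D + 1))%:C by near: y; exact: cvgr_dist_lt.
  rewrite rnormE ltcR ltr_pdivlMr// mulrC; apply: le_lt_trans.
  by rewrite ler_wpM2r ?rnorm_ge0// lerDl.
- by apply: inj; rewrite (hg _).1.
- exact: (hg x).1.
Unshelve. all: by end_near.
Qed.

End Operator.
End SpectralRadius.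

Lemma continuous_linear_rnorm_bounded (K : realType) (V : normedModType K[i])
    (g : {linear V -> V}) : continuous (g : V -> V) ->
  exists G, 0 <= G /\ forall x, rnorm (g x) <= G * rnorm x.
Proof.
move=> /linear_bounded_continuous/linear_boundedP/pinfty_ex_gt0[r].
rewrite ltcE => /andP[/= /eqP ri r0] h; exists (complex.Re r).
have rE : r = (complex.Re r)%:C by case: r ri {r0 h} => a b /= ->.
split=> [|x]; first exact: ltW.
by have := h x; rewrite !rnormE rE -rmorphM lecR.
Qed.

(** Stands in for the limit s -> r with N fixed: it turns the bound s^N / 4 into r^N / 2. *)
Lemma exprn_right_approx (K : realType) (r d : K) N : 0 < r -> 0 < d ->
  exists s, [/\ r < s, s <= r + d & s ^+ N <= 2 * r ^+ N].
Proof.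
move=> r0 d0; have rN : 0 < r ^+ N by rewrite exprn_gt0.
have /cvgrPdist_lt /(_ _ rN) := @exprn_continuous K N r.
rewrite -nbhs_ballE => -[/= e e0 h].
have m0 : 0 < Num.min (e / 2) d by rewrite lt_min d0 divr_gt0.
have me : Num.min (e / 2) d <= e / 2 by rewrite ge_min lexx.
have md : Num.min (e / 2) d <= d by rewrite ge_min lexx orbT.
exists (r + Num.min (e / 2) d); split; [by rewrite ltrDl|by rewrite lerD2l|].
have : ball r e (r + Num.min (e / 2) d).
  rewrite -ball_normE/= opprD addrA subrr add0r normrN gtr0_norm//.
  by rewrite (le_lt_trans me)// ltr_pdivrMr// mulr_natr mulr2n ltrDl.
move/h; rewrite distrC => /(le_lt_trans (ler_norm _)); lra.
Qed.

(** * The infimal growth rate as the largest modulus in the spectrum *)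

Section SpectralRadiusFormula.
Variables (K : realType) (I : choiceType) (L : banach_seq_space K I).
Hypothesis hL : normalized L.
Implicit Types (u v : I -> K) (A B : I -> I -> K).
Local Notation posop := (posop L).
Local Notation inL := (inL L).
Local Notation nrm := (nrm L).
Local Notation c := (bss_coord L).
Local Notation p A n := (mat_norm L (mat_exp A n)).
Local Notation growth := (growth L).

Definition growth_radius A : K := inf [set s | 0 < s /\ growth A s].

Section Resolvent.
Variable A : I -> I -> K.
Hypothesis pA : posop A.
Let f : L -> L := @mat_op K I L A.
Local Notation r := (growth_radius A).

Lemma growth_radius_has_inf : has_inf [set s | 0 < s /\ growth A s].
Proof.
split; last by exists 0 => s [/ltW].
exists (mat_norm L A + 1); split; last exact: growth_norm.
by rewrite ltr_wpDl// mat_norm_ge0.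
Qed.

Lemma growth_radius_ge0 : 0 <= r.
Proof. by apply: lb_le_inf => [|s [/ltW//]]; case: growth_radius_has_inf. Qed.

Lemma growth_radius_le s : 0 < s -> growth A s -> r <= s.
Proof. by move=> s0 gs; apply: ge_inf => //; case: growth_radius_has_inf. Qed.

Lemma growth_above s : r < s -> growth A s.
Proof.
move=> rs; have d0 : 0 < s - r by rewrite subr_gt0.
have [t [t0 gt]] := inf_adherent d0 growth_radius_has_inf.
by rewrite -/r addrC subrK => /ltW ts; apply: growth_le gt; rewrite t0.
Qed.

Definition partial_resolvent (s : K) M u : I -> K := fun i =>
  \sum_(0 <= n < M) s ^- n.+1 * act (mat_exp A n) u i.

Lemma coord_mat_op_iter u x n : inL u -> c x = of_real u ->
  c (iter n f x) = of_real (act (mat_exp A n) u).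
Proof.
move=> uL cx; rewrite (act_exp hL)//; elim: n => [|n IH] //=.
have vL : inL (iter n (act A) u).
  by rewrite -(act_exp hL)//; apply: posop_inL => //; exact: posop_exp.
rewrite {1}/f mat_opE// IH mat_act_real//; first by case: pA.
by move=> i; exact: (posop_summ i pA vL).
Qed.

Lemma coord_neumann (s : K) u x M : inL u -> c x = of_real u ->
  c (neumann A s%:C x M) = of_real (partial_resolvent s M u).
Proof.
move=> uL cx; apply/funext => i; rewrite /neumann bss_coord_sum.
rewrite /of_real /partial_resolvent rmorph_sum; apply: eq_bigr => n _.
by rewrite bss_coordZ (coord_mat_op_iter n uL cx) /of_real rmorphM fmorphV rmorphXn.
Qed.

Lemma act_exp_ge0 u n i : inL u -> 0 <= act (mat_exp A n) u i.
Proof. by move=> uL; apply: (@inL_ge0 _ _ L); apply: posop_inL => //; exact: posop_exp. Qed.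

Lemma partial_resolvent_ge0 s M u i : 0 < s -> inL u -> 0 <= partial_resolvent s M u i.
Proof.
move=> s0 uL; apply: sumr_ge0 => n _.
by rewrite mulr_ge0 ?act_exp_ge0// invr_ge0 exprn_ge0// ltW.
Qed.

Lemma partial_resolvent_term s M u i n : 0 < s -> inL u -> (n < M)%N ->
  s ^- n.+1 * act (mat_exp A n) u i <= partial_resolvent s M u i.
Proof.
move=> s0 uL nM; rewrite /partial_resolvent (bigD1_seq n)/= ?mem_index_iota ?iota_uniq//.
rewrite lerDl sumr_ge0// => k _.
by rewrite mulr_ge0 ?act_exp_ge0// invr_ge0 exprn_ge0// ltW.
Qed.

Lemma partial_resolvent_le s N M u i : 0 < s -> inL u -> (N <= M)%N ->
  partial_resolvent s N u i <= partial_resolvent s M u i.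
Proof.
move=> s0 uL NM; rewrite /partial_resolvent (big_cat_nat (leq0n N) NM)/=.
rewrite lerDl sumr_ge0// => k _.
by rewrite mulr_ge0 ?act_exp_ge0// invr_ge0 exprn_ge0// ltW.
Qed.

(* If r is not in the spectrum, the partial sums of the resolvent series at s stay
   bounded as s decreases to r. *)
Lemma partial_resolvent_bounded (g : {linear L -> L}) (G s : K) N u :
  0 < r -> 0 <= G -> (forall x, rnorm (g x) <= G * rnorm x) ->
  (forall x, g (r%:C *: x - f x) = x) ->
  r < s -> (s - r) * G <= 2^-1 -> inL u ->
  inL (partial_resolvent s N u) /\ nrm (partial_resolvent s N u) <= 4 * G * nrm u.
Proof.
move=> r0 G0 hG gf rs sG uL.
have s0 : 0 < s := lt_trans r0 rs.
have [x cx <-] := inL_repr uL.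
(* A rate strictly between r and s: A^n is bounded by C s'^n, and (s' / s)^n tends to 0. *)
pose s' := (r + s) / 2.
have rs' : r < s' by rewrite /s'; lra.
have s's : s' < normc s%:C by rewrite normc_real gtr0_norm// /s'; lra.
have s'0 : 0 < s' := lt_trans r0 rs'.
have [C [C0 hC]] := growth_above rs'.
have [z0 nz0 q01] := growth_lt1 s'0 s's.
have [M0 hM0] := geometric_lt C q01 ltr01.
(* M is large enough for the telescoping remainder to have norm at most that of x, and M >= N lets
   positivity pass the bound from the M-th partial sum down to the N-th. *)
pose M := (M0 + N)%N.
have w1 : rnorm ((s%:C) ^- M *: iter M f x) <= rnorm x.
  apply: (le_trans (rnorm_scaled_iter hL pA x s'0 s's (hC M))).
  rewrite mulrAC ler_piMl ?rnorm_ge0//; apply: le_trans (ltW hM0).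
  rewrite ler_wpM2l// exprD ler_piMr//; first by case/andP: q01 => q0 _; exact: exprn_ge0.
  by case/andP: q01 => q0 q1; rewrite exprn_ile1// ltW.
set S := neumann A s%:C x M.
have tel : s%:C *: S - f S = x - (s%:C) ^- M *: iter M f x by exact: neumann_telescope.
(* Rewrite the telescoped identity as (r - f) S = x - remainder - (s - r) S and apply g. As (s - r)
   G <= 1/2, the last term absorbs into the left side, and 4 G comes from 2 * G * 2. *)
have SE : S = g (x - (s%:C) ^- M *: iter M f x - (s - r)%:C *: S).
  rewrite -tel -[LHS]gf; congr (g _).
  by rewrite rmorphB scalerBl opprB addrAC addrCA subrr addr0.
have Sle : rnorm S <= 4 * G * rnorm x.
  have h1 := hG (x - (s%:C) ^- M *: iter M f x - (s - r)%:C *: S); rewrite -SE in h1.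
  have h2 := ler_rnormD (x - (s%:C) ^- M *: iter M f x) (- ((s - r)%:C *: S)).
  have h3 := ler_rnormD x (- ((s%:C) ^- M *: iter M f x)).
  rewrite rnormN in h3; rewrite rnormN rnormZ normc_real ger0_norm ?subr_ge0 ?(ltW rs)// in h2.
  have h4 : G * rnorm (x - (s%:C) ^- M *: iter M f x - (s - r)%:C *: S) <=
      G * (2 * rnorm x + (s - r) * rnorm S).
    by rewrite ler_wpM2l//; lra.
  have h5 : (s - r) * G * rnorm S <= 2^-1 * rnorm S by rewrite ler_wpM2r ?rnorm_ge0.
  nra.
have [i|uN nN] := @inL_dom _ _ L (partial_resolvent s N u) S.
  rewrite (partial_resolvent_ge0 _ _ s0 uL)/= (coord_neumann s M uL cx) normc_real.
  rewrite (le_trans _ (ler_norm _))// partial_resolvent_le// /M leq_addl//.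
by split=> //; exact: le_trans nN Sle.
Qed.

Lemma act_scale B u v (a : K) i : posop B -> inL u -> inL v -> 0 <= a ->
  (forall j, a * u j <= v j) -> a * act B u i <= act B v i.
Proof.
move=> pB uL vL a0 uv.
rewrite /act -(nsumZ a0 (posop_summ i pB uL)).2.
have [] // := @le_nsum _ _ (fun j => a * (B i j * u j)) _ _ (posop_summ i pB vL) => j.
have B0 : 0 <= B i j by case: pB.
rewrite !mulr_ge0 ?(inL_ge0 j uL)//= mulrCA; exact: ler_wpM2l.
Qed.

(** Each of the N + 1 splittings N = n + (N - n) contributes s^-(N+2) A^N u to the double sum, whose
    other terms are non-negative. *)
Lemma partial_resolvent_square s N u i : 0 < s -> inL u ->
  inL (partial_resolvent s N.+1 u) ->
  0 <= N.+1%:R * s ^- N.+2 * act (mat_exp A N) u i <=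
    partial_resolvent s N.+1 (partial_resolvent s N.+1 u) i.
Proof.
move=> s0 uL vL.
have si0 k : 0 <= s ^- k by rewrite invr_ge0 exprn_ge0// ltW.
apply/andP; split; first by rewrite !mulr_ge0 ?act_exp_ge0 ?ler0n.
rewrite /partial_resolvent big_mkord -mulrA -[X in X%:R]card_ord mulr_natl -sumr_const.
apply: ler_sum => -[n nN] _ /=.
have -> : act (mat_exp A N) u i = act (mat_exp A n) (act (mat_exp A (N - n)) u) i.
  have nN' : (n <= N)%N by [].
  rewrite -(mat_mul_act hL) //; do ?[exact: posop_exp].
  by rewrite -(mat_expD hL)// subnKC.
have -> : s ^- N.+2 = s ^- n.+1 * s ^- (N - n).+1.
  rewrite -invfM -exprD; congr (s ^- _); have nN' : (n <= N)%N by [].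
  by rewrite addSn addnS subnKC.
rewrite -mulrA ler_wpM2l//; apply: act_scale => //.
- exact: posop_exp.
- by apply: posop_inL => //; exact: posop_exp.
- move=> j; apply: partial_resolvent_term => //.
  by rewrite ltnS leq_subr.
Qed.

Lemma growth_radius_spectrum : 0 < r -> spectrum f r%:C.
Proof.
move=> r0 [g [gc gf _]].
have [G [G0 hG]] := continuous_linear_rnorm_bounded gc.
(* Chosen so that s - r <= d implies (s - r) G <= 1/2; the added 1 covers G = 0. *)
pose d := (2 * (G + 1))^-1.
have d0 : 0 < d by rewrite invr_gt0 mulr_gt0// ltr_wpDl.
have dG : d * G <= 2^-1.
  rewrite /d invfM -mulrA ler_piMr ?invr_ge0//.
  by rewrite mulrC ler_pdivrMr ?mul1r ?lerDl// ltr_wpDl.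
(* 16 G^2 comes from applying the bound 4 G twice, (r + d)^2 dominates the s^2 in s^(N+2) = s^N s^2,
   and the last 4 yields the quarter in [bound]. *)
pose D := 16 * G ^+ 2 * (r + d) ^+ 2 * 4.
have D0 : 0 <= D by rewrite /D !(mulr_ge0, exprn_ge0, addr_ge0)// ltW.
have [N [Npos DN]] : exists N, (0 < N)%N /\ D <= N.+1%:R.
  exists (Num.truncn D).+1; split=> //.
  by rewrite (le_trans (ltW (truncnS_gt D)))// ler_nat.
have bound s : r < s -> s <= r + d -> p A N <= s ^+ N / 4.
  move=> rs sd; have s0 : 0 < s := lt_trans r0 rs.
  have sG : (s - r) * G <= 2^-1.
    by apply: le_trans dG; rewrite ler_wpM2r//; lra.
  apply: (mat_norm_min hL); first exact: posop_exp.
    by rewrite divr_ge0// exprn_ge0// ltW.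
  move=> u uL.
  have [vL nv] := partial_resolvent_bounded N.+1 r0 G0 hG gf rs sG uL.
  have [wL nw] := partial_resolvent_bounded N.+1 r0 G0 hG gf rs sG vL.
  have [_ le] := inL_le wL (fun i => partial_resolvent_square i s0 uL vL).
  have k0 : 0 <= N.+1%:R * s ^- N.+2 by rewrite mulr_ge0 ?ler0n// invr_ge0 exprn_ge0// ltW.
  rewrite (inLZ k0 (posop_inL (posop_exp hL N pA) uL)).2 in le.
  have t1 : N.+1%:R * s ^- N.+2 * nrm (act (mat_exp A N) u) <= 16 * G ^+ 2 * nrm u.
    apply: (le_trans le); apply: (le_trans nw).
    have -> : 16 * G ^+ 2 * nrm u = 4 * G * (4 * G * nrm u) by ring.
    by rewrite ler_wpM2l// mulr_ge0.
  have sN2 : 0 < s ^+ N.+2 by rewrite exprn_gt0.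
  rewrite mulrAC ler_pdivrMr// in t1.
  have s2 : s ^+ 2 <= (r + d) ^+ 2 by rewrite lerXn2r// ?nnegrE ?ltW// addr_gt0.
  have n0 : 0 <= nrm u := nrm_ge0 L u.
  have N0 : 0 < N.+1%:R :> K by rewrite ltr0n.
  rewrite -(ler_pM2l N0); apply: (le_trans t1).
  rewrite (_ : s ^+ N.+2 = s ^+ N * s ^+ 2); last by rewrite -exprD addn2.
  have -> : 16 * G ^+ 2 * nrm u * (s ^+ N * s ^+ 2) =
    (16 * G ^+ 2 * s ^+ 2 * 4) * (s ^+ N / 4 * nrm u) by field.
  rewrite ler_wpM2r//.
    by rewrite mulr_ge0// divr_ge0// exprn_ge0// ltW.
  apply: le_trans DN; rewrite /D ler_wpM2r// ler_wpM2l//.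
  by rewrite mulr_ge0// exprn_ge0.
have [s [rs sd s2]] := exprn_right_approx N r0 d0.
have pN : p A N <= r ^+ N / 2 by have := bound s rs sd; lra.
(* t < r but t^N = r^N / 2, so [pN] makes t an admissible growth rate below the infimum. *)
pose t := r * (2^-1 `^ (N%:R^-1)).
have h1 : 2^-1 `^ (N%:R^-1) ^+ N = 2^-1 :> K.
  by rewrite -powR_mulrn ?powR_ge0// -powRrM mulVf ?powRr1// pnatr_eq0 -lt0n.
have t0 : 0 < t by rewrite mulr_gt0// powR_gt0// invr_gt0.
have gt : growth A t.
  by apply: (@growth_of_exp _ _ _ hL _ _ N) => //; rewrite /t exprMn h1.
have := growth_radius_le t0 gt; rewrite leNgt => /negP; apply.
rewrite /t gtr_pMr// ltNge; apply/negP => ge1.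
have : 1 <= (2^-1 `^ (N%:R^-1)) ^+ N :> K by exact: exprn_ege1.
by rewrite h1; lra.
Qed.

Lemma spectral_bound z : spectrum f z -> normc z <= r.
Proof.
move=> sz; rewrite leNgt; apply/negP => rz.
pose s := (r + normc z) / 2.
have rs : r < s by rewrite /s; lra.
have s0 : 0 < s := le_lt_trans growth_radius_ge0 rs.
by apply: (not_spectrum_growth hL pA s0 (growth_above rs) _ sz); rewrite /s; lra.
Qed.

Lemma mat_rho_growth_radius : mat_rho L A = r.
Proof.
rewrite /mat_rho /spectral_radius -/f.
have hub : ubound [set normc z | z in spectrum f] r.
  by move=> _ [z sz <-]; exact: spectral_bound.
have [[z0 sz0]|ns] := pselect (exists z, spectrum f z).
  apply/eqP; rewrite eq_le; apply/andP; split.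
    by apply: ge_sup => //; exists (normc z0); exists z0.
  have [r0|r0] := leP r 0.
    rewrite (le_trans r0)// (le_trans (normc_ge0 z0))//; apply: ub_le_sup; last by exists z0.
    by exists r.
  apply: ub_le_sup; first by exists r.
  exists r%:C; first exact: growth_radius_spectrum.
  by rewrite normc_real gtr0_norm.
(* On an empty spectrum [sup] takes the default value 0; r > 0 would put r in the spectrum, hence r
   = 0 too. *)
rewrite (_ : [set normc z | z in spectrum f] = set0); last first.
  by apply/seteqP; split=> [w [z sz _]|//]; case: ns; exists z.
rewrite sup0; apply/eqP; rewrite eq_le growth_radius_ge0/= leNgt.
by apply/negP => r0; apply: ns; exists r%:C; exact: growth_radius_spectrum.
Qed.

End Resolvent.

(** * Spectral radius inequalities: monotonicity, powers, commutation, Hadamard means *)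

Lemma mat_rho_ge0 A : posop A -> 0 <= mat_rho L A.
Proof. by move=> pA; rewrite mat_rho_growth_radius// growth_radius_ge0. Qed.

Lemma mat_rho_le_growth A s : posop A -> 0 < s -> growth A s -> mat_rho L A <= s.
Proof. by move=> pA s0 gs; rewrite mat_rho_growth_radius// growth_radius_le. Qed.

Lemma growth_gt_rho A s : posop A -> mat_rho L A < s -> growth A s.
Proof. by move=> pA; rewrite mat_rho_growth_radius//; exact: growth_above. Qed.

(** [growth] is available at rates strictly above the spectral radius, so the comparisons below run
    over all such rates. *)
Lemma ler_above (x y : K) : (forall s, y < s -> x <= s) -> x <= y.
Proof. by move=> h; apply/ler_addgt0Pr => e e0; apply: h; rewrite ltrDl. Qed.

Lemma mat_rho_le A B : posop B -> (forall i j, 0 <= A i j <= B i j) ->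
  mat_rho L A <= mat_rho L B.
Proof.
move=> pB AB; have pA := posop_le pB AB; apply: ler_above => s Bs.
have s0 : 0 < s := le_lt_trans (mat_rho_ge0 pB) Bs.
have [C [C0 hC]] := growth_gt_rho pB Bs.
apply: (mat_rho_le_growth pA s0); exists C; split=> [//|n].
apply: le_trans (hC n); apply: (mat_norm_le hL); first exact: posop_exp.
by move=> i j; exact: (mat_exp_le hL).
Qed.

(** A rate s for A^m is the rate s^(1/m) for A along multiples of m, and [growth_subseq] fills in
    the other powers. *)
Lemma mat_rho_exp A m : posop A -> (0 < m)%N ->
  mat_rho L A <= mat_rho L (mat_exp A m) `^ m%:R^-1.
Proof.
move=> pA m0; have pm := posop_exp hL m pA.
have mn0 : m%:R != 0 :> K by rewrite pnatr_eq0 -lt0n.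
have rA := mat_rho_ge0 pA; have rm := mat_rho_ge0 pm.
suff h : mat_rho L A ^+ m <= mat_rho L (mat_exp A m).
  have -> : mat_rho L A = (mat_rho L A ^+ m) `^ m%:R^-1.
    by rewrite -powR_mulrn// -powRrM divff// powRr1.
  by apply: (le_powR _ (exprn_ge0 m rA) h); rewrite invr_ge0 ler0n.
apply: ler_above => s hs; have s0 : 0 < s := le_lt_trans rm hs.
have [C [C0 hC]] := growth_gt_rho pm hs.
pose t := s `^ m%:R^-1; have t0 : 0 < t by exact: powR_gt0.
have tm : t ^+ m = s by rewrite -powR_mulrn ?ltW// -powRrM mulVf// powRr1// ltW.
suff h : mat_rho L A <= t.
  rewrite -tm; apply: lerXn2r h; rewrite nnegrE; first exact: rA.
  exact: ltW t0.
apply: (mat_rho_le_growth pA t0).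
apply: (@growth_subseq _ _ _ hL _ t C m) => // q.
by rewrite (mat_expM hL)// exprM tm.
Qed.

(** (A B)^(n+1) = A (B A)^n B, so a rate for B A is one for A B; the division by s in the constant
    repairs the shift of the exponent and the summand 1 covers n = 0. *)
Lemma mat_rho_mulC A B : posop A -> posop B ->
  mat_rho L (mat_mul A B) <= mat_rho L (mat_mul B A).
Proof.
move=> pA pB; have pAB := posop_mat_mul hL pA pB; have pBA := posop_mat_mul hL pB pA.
apply: ler_above => s hs; have s0 : 0 < s := le_lt_trans (mat_rho_ge0 pBA) hs.
have [C [C0 hC]] := growth_gt_rho pBA hs.
apply: (mat_rho_le_growth pAB s0).
have nA := mat_norm_ge0 hL pA; have nB := mat_norm_ge0 hL pB.
have k0 : 0 <= mat_norm L A * C * mat_norm L B / s.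
  exact: divr_ge0 (mulr_ge0 (mulr_ge0 nA C0) nB) (ltW s0).
exists (1 + mat_norm L A * C * mat_norm L B / s); split=> [|[|n]].
- exact: addr_ge0 ler01 k0.
- rewrite expr0 mulr1 mat_expE/=; apply: (le_trans (mat_norm_one hL)).
  by rewrite lerDl; exact: k0.
have -> : mat_exp (mat_mul A B) n.+1 = mat_mul A (mat_mul (mat_exp (mat_mul B A) n) B).
  elim: n => [|n IH].
    by rewrite mat_expS !mat_expE/= (mat_mul1r hL)// (mat_mul1l hL).
  have pn := posop_exp hL n pBA.
  rewrite mat_expS IH mat_expS.
  rewrite -!(mat_mulA hL)//; do ?[apply: (posop_mat_mul hL) => //].
have pn := posop_exp hL n pBA.
apply: (le_trans (mat_norm_mul hL pA (posop_mat_mul hL pn pB))).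
apply: (@le_trans _ _ (mat_norm L A * (C * s ^+ n * mat_norm L B))).
  apply: (ler_wpM2l nA); apply: (le_trans (mat_norm_mul hL pn pB)).
  exact: (ler_wpM2r nB (hC n)).
have -> : mat_norm L A * (C * s ^+ n * mat_norm L B) =
    mat_norm L A * C * mat_norm L B / s * s ^+ n.+1.
  move: (mat_norm L A) (mat_norm L B) => a b.
  by rewrite exprS; field; rewrite gt_eqF.
apply: ler_wpM2r; first by rewrite exprn_ge0// ltW.
by rewrite lerDr; exact: ler01.
Qed.

(** An error linear in e, so that letting e tend to 0 in a product of spectral radii amounts to
    choosing e. *)
Lemma prodr_shift_le (J : Type) (l : seq J) (x : J -> K) : (forall j, 0 <= x j) ->
  exists D, 0 <= D /\ forall e, 0 <= e <= 1 ->
    \prod_(j <- l) (x j + e) <= \prod_(j <- l) x j + e * D.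
Proof.
move=> x0; elim: l => [|j l [D [D0 IH]]].
  by exists 0; split=> // e _; rewrite !big_nil mulr0 addr0.
have P0 : 0 <= \prod_(j <- l) x j by exact: prodr_ge0.
exists (\prod_(j <- l) x j + x j * D + D); split=> [|e e01].
  by rewrite !addr_ge0// mulr_ge0.
have /andP[e0 e1] := e01.
rewrite !big_cons (le_trans (ler_wpM2l _ (IH e e01))) ?addr_ge0//.
have -> : (x j + e) * (\prod_(j <- l) x j + e * D) =
  x j * \prod_(j <- l) x j + e * (\prod_(j <- l) x j + x j * D + e * D) by ring.
by rewrite lerD2l ler_wpM2l// lerD2l ler_piMl.
Qed.

(** Powers of a Hadamard mean lie below the Hadamard mean of the powers, whose norm is controlled by
    rates slightly above each spectral radius. *)
Lemma mat_rho_hadamard_mean m (a : K) (F : 'I_m -> I -> I -> K) :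
  (0 < m)%N -> 1 <= m%:R * a -> (forall k, posop (F k)) ->
  mat_rho L (hadamard_prod (fun k => hadamard_pow (F k) a)) <=
    \prod_(k < m) mat_rho L (F k) `^ a.
Proof.
move=> m0 ma pF.
have a0 : 0 < a.
  have mgt0 : 0 < m%:R :> K by rewrite ltr0n.
  by rewrite -(pmulr_rgt0 _ mgt0) (lt_le_trans ltr01).
set H := hadamard_prod _.
have [pH _] := hadamard_mean_norm hL m0 ma pF.
have r0 k : 0 <= mat_rho L (F k) by exact: mat_rho_ge0.
have above (e : K) : 0 < e -> mat_rho L H <= (\prod_(k < m) (mat_rho L (F k) + e)) `^ a.
  move=> e0; pose s k := mat_rho L (F k) + e.
  have s0 k : 0 < s k by rewrite ltr_wpDl.
  have /choice[C hC] : forall k, exists C, 0 <= C /\ forall n, p (F k) n <= C * s k ^+ n.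
    by move=> k; apply: growth_gt_rho => //; rewrite ltrDl.
  rewrite powR_prod; last by move=> k; exact: (ltW (s0 k)).
  have S0 : 0 < \prod_(k < m) s k `^ a by apply: prodr_gt0 => k _; exact: powR_gt0.
  apply: (mat_rho_le_growth pH S0).
  exists (\prod_(k < m) C k `^ a); split=> [|n].
    by apply: prodr_ge0 => k _; exact: powR_ge0.
  pose G := hadamard_prod (fun k => hadamard_pow (mat_exp (F k) n) a).
  have pFn k := posop_exp hL n (pF k).
  have [pG nG] := hadamard_mean_norm hL m0 ma pFn.
  have HG i j : 0 <= mat_exp H n i j <= G i j.
    exact: (@hadamard_mean_prod K I L hL m a m0 ma _ (index_enum 'I_n) (fun _ => F)).
  apply: (le_trans (mat_norm_le hL pG HG)); apply: (le_trans nG).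
  rewrite -prodrXl -big_split/=; apply: ler_prod => k _; rewrite powR_ge0/=.
  have [C0 hk] := hC k.
  rewrite -powR_mulrn ?powR_ge0// powRAC powR_mulrn ?(ltW (s0 k))//.
  rewrite -powRM ?exprn_ge0 ?(ltW (s0 k))//.
  have sn0 : 0 <= s k ^+ n by rewrite exprn_ge0 ?ltW.
  apply: ge0_ler_powR; rewrite ?nnegrE ?(ltW a0)//; first exact: norm_exp_ge0.
  by rewrite mulr_ge0.
have P0 : 0 <= \prod_(k < m) mat_rho L (F k) by exact: prodr_ge0.
have rH := mat_rho_ge0 pH.
have ai0 : 0 <= a^-1 by rewrite invr_ge0 ltW.
rewrite -powR_prod//.
(* Removing the exponent a first leaves a plain product on the right, where [prodr_shift_le]
   applies. *)
suff h : mat_rho L H `^ a^-1 <= \prod_(k < m) mat_rho L (F k).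
  have -> : mat_rho L H = (mat_rho L H `^ a^-1) `^ a.
    by rewrite -powRrM mulVf ?lt0r_neq0// powRr1.
  by apply: ge0_ler_powR; rewrite ?nnegrE ?powR_ge0// ltW.
have [D [D0 hD]] := prodr_shift_le (index_enum 'I_m) r0.
apply/ler_addgt0Pr => e e0.
pose e' := Num.min 1 (e / (D + 1)).
have D1 : 0 < D + 1 by rewrite ltr_wpDl.
have e'0 : 0 < e' by rewrite lt_min ltr01 divr_gt0.
have e'1 : e' <= 1 by rewrite ge_min lexx.
have e'D : e' * D <= e.
  apply: (@le_trans _ _ (e / (D + 1) * (D + 1))); last by rewrite divfK ?gt_eqF.
  apply: ler_pM => //; first exact: ltW.
    by rewrite ge_min lexx orbT.
  by rewrite lerDl.
have e'01 : 0 <= e' <= 1 by rewrite ltW.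
apply: (@le_trans _ _ (\prod_(k < m) (mat_rho L (F k) + e'))); last first.
  by rewrite (le_trans (hD _ e'01))// lerD2l.
have Q0 : 0 <= \prod_(k < m) (mat_rho L (F k) + e').
  by apply: prodr_ge0 => k _; exact: addr_ge0 (r0 k) (ltW e'0).
have -> : \prod_(k < m) (mat_rho L (F k) + e') =
    ((\prod_(k < m) (mat_rho L (F k) + e')) `^ a) `^ a^-1.
  by rewrite -powRrM mulfV ?lt0r_neq0// powRr1.
by apply: ge0_ler_powR; rewrite ?nnegrE ?powR_ge0//; exact: above.
Qed.

End SpectralRadiusFormula.

(** * The numerical radius on l2 *)

Section NumericalRadius.
Variables (K : realType) (I : choiceType) (L : banach_seq_space K I).
Hypotheses (hL : normalized L) (h2 : is_l2 L).
Implicit Types (u v : I -> K) (A B : I -> I -> K).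
Local Notation posop := (posop L).
Local Notation inL := (inL L).
Local Notation nrm := (nrm L).
Local Notation c := (bss_coord L).

Definition quad A u : K := nsum (fun i => act A u i * u i).

Lemma l2_coord (x : L) :
  summ (fun i => normc (c x i) ^+ 2) /\ rnorm x ^+ 2 = nsum (fun i => normc (c x i) ^+ 2).
Proof.
have [r2 n2] := h2.
have : l2 (c x) by rewrite -r2; exists x.
have x0 i : 0 <= normc (c x i) ^+ 2 by rewrite exprn_ge0 ?normc_ge0.
move=> sx; split=> //; rewrite n2 sqr_sqrtr//; exact: nsum_ge0.
Qed.

Lemma inL_l2 u : inL u -> summ (fun i => u i ^+ 2) /\ nrm u ^+ 2 = nsum (fun i => u i ^+ 2).
Proof.
move=> uL; have [y cy <-] := inL_repr uL; have := l2_coord y.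
suff -> : (fun i => normc (c y i) ^+ 2) = (fun i => u i ^+ 2) by [].
by apply/funext => i; rewrite cy normc_real ger0_norm ?(inL_ge0 i uL).
Qed.

(** 2 x y <= x^2 + y^2 termwise gives a crude constant, enough to make the form and the supremum
    over unit vectors finite. *)
Lemma summ_quad A u : posop A -> inL u ->
  summ (fun i => act A u i * u i) /\
  quad A u <= (mat_norm L A ^+ 2 + 1) / 2 * nrm u ^+ 2.
Proof.
move=> pA uL; have vL := posop_inL pA uL.
have [su nu] := inL_l2 uL; have [sv nv] := inL_l2 vL.
have [sD nD] := nsumD sv su.
have h0 : 0 <= 2^-1 :> K by rewrite invr_ge0.
have [sZ nZ] := nsumZ h0 sD.
have [] := @le_nsum _ _ (fun i => act A u i * u i) _ _ sZ.
  move=> i; rewrite mulr_ge0 ?(inL_ge0 i uL) ?(inL_ge0 i vL)//=.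
  by have := sqr_ge0 (act A u i - u i); rewrite sqrrB; lra.
move=> ? le; split=> //; apply: (le_trans le); rewrite nZ nD -nu -nv.
have le2 : nrm (act A u) ^+ 2 <= (mat_norm L A * nrm u) ^+ 2.
  by rewrite lerXn2r ?nnegrE ?mulr_ge0 ?nrm_ge0 ?(mat_norm_ge0 hL)// (nrm_act_le hL).
by move: le2; rewrite exprMn; lra.
Qed.

Lemma quad_ge0 A u : posop A -> inL u -> 0 <= quad A u.
Proof.
move=> pA uL; apply: nsum_ge0 => i.
by rewrite mulr_ge0 ?(inL_ge0 i uL) ?(inL_ge0 i (posop_inL pA uL)).
Qed.

Lemma l2_repr (x : I -> K[i]) : l2 x -> l2_norm x = 1 ->
  exists2 y : L, c y = x & rnorm y = 1.
Proof.
have [r2 n2] := h2; rewrite -r2 => -[y _ <-] y1.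
by exists y => //; rewrite n2.
Qed.

Lemma normc_conjc (z : K[i]) : normc (conjc z) = normc z.
Proof. by case: z => a b; rewrite /= sqrrN. Qed.

Lemma l2_inner_le A (y : L) : posop A ->
  normc (l2_inner (mat_act A (c y)) (c y)) <= quad A (fun i => normc (c y i)).
Proof.
move=> pA; have [yL _] := inL_abs y.
pose g i := mat_act A (c y) i * conjc (c y i).
have [sq _] := summ_quad pA yL.
have [|sg le] := @le_nsum _ _ (fun i => normc (g i)) _ _ sq.
  move=> i; rewrite normc_ge0 /g normcM normc_conjc ler_wpM2r ?normc_ge0//.
  exact: mat_act_le.
have [s hs ls] := has_csum_normc sg.
by rewrite /l2_inner (has_csum_sum hs) (le_trans ls).
Qed.

Lemma l2_inner_real A u : posop A -> inL u ->
  l2_inner (mat_act A (of_real u)) (of_real u) = (quad A u)%:C.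
Proof.
move=> pA uL; rewrite mat_act_real; first last.
- by move=> i; exact: (posop_summ i pA uL).
- by case: pA.
apply: has_csum_sum.
have -> : (fun i => of_real (act A u) i * conjc (of_real u i)) =
    (fun i => (act A u i * u i)%:C).
  by apply/funext => i; rewrite /of_real conjc_real -rmorphM.
by apply: has_csum_nneg; have [] := summ_quad pA uL.
Qed.

Lemma quadZ A u (r : K) : posop A -> inL u -> 0 <= r ->
  quad A (fun i => r * u i) = r ^+ 2 * quad A u.
Proof.
move=> pA uL r0; have [sq _] := summ_quad pA uL.
rewrite -(nsumZ (exprn_ge0 2 r0) sq).2; congr nsum; apply/funext => i.
have -> : act A (fun j => r * u j) i = r * act A u i.
  rewrite /act -(nsumZ r0 (posop_summ i pA uL)).2.
  by congr nsum; apply/funext => j; rewrite mulrCA.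
ring.
Qed.

(** |<A x, x>| <= <A |x|, |x|> reduces the supremum to non-negative vectors, and homogeneity of
    degree 2 extends it from unit vectors to all. *)
Lemma num_radiusP A : posop A ->
  [/\ 0 <= num_radius A,
    forall u, inL u -> quad A u <= num_radius A * nrm u ^+ 2 &
    forall C, 0 <= C -> (forall u, inL u -> quad A u <= C * nrm u ^+ 2) ->
      num_radius A <= C].
Proof.
move=> pA.
set S := [set normc (l2_inner (mat_act A x) x) | x in [set x | l2 x /\ l2_norm x = 1]].
have ub C : (forall u, inL u -> quad A u <= C * nrm u ^+ 2) -> ubound S C.
  move=> hC _ [x [x2 x1] <-]; have [y <- y1] := l2_repr x2 x1.
  have [yL ny] := inL_abs y.
  rewrite (le_trans (l2_inner_le y pA))// (le_trans (hC _ yL))//.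
  by rewrite ny y1 expr1n mulr1.
have hub : has_ubound S.
  exists ((mat_norm L A ^+ 2 + 1) / 2); apply: ub => u uL.
  by have [] := summ_quad pA uL.
have S0 : 0 <= num_radius A.
  (* Without unit vectors [S] is empty and [sup] takes the default value 0. *)
  rewrite /num_radius -/S; have [[w Sw]|n] := pselect (exists w, S w).
    apply: (le_trans _ (ub_le_sup hub Sw)).
    by case: Sw => x _ <-; exact: normc_ge0.
  rewrite (_ : S = set0) ?sup0//; apply/seteqP; split=> [w Sw|//].
  by case: n; exists w.
split=> // [u uL|C C0 hC]; last first.
  rewrite /num_radius -/S; have [[w Sw]|n] := pselect (exists w, S w).
    by apply: ge_sup; [exists w|exact: ub].
  rewrite (_ : S = set0) ?sup0//; apply/seteqP; split=> [w Sw|//].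
  by case: n; exists w.
have [u0|un0] := eqVneq (nrm u) 0.
  by rewrite (le_trans (summ_quad pA uL).2)// u0 expr0n/= !mulr0.
have ugt0 : 0 < nrm u by rewrite lt_def un0 nrm_ge0.
have ui0 : 0 <= (nrm u)^-1 by rewrite invr_ge0 ltW.
have [vL nv] := inLZ ui0 uL; rewrite mulVf// in nv.
set v := (fun i => _) in vL nv.
have qv : quad A v <= num_radius A.
  rewrite /num_radius -/S; apply: ub_le_sup => //.
  exists (of_real v); last first.
    by rewrite l2_inner_real// normc_real ger0_norm ?quad_ge0.
  have [y cy ny] := inL_repr vL; have [r2 n2] := h2.
  split; first by rewrite -r2; exists y.
  by rewrite -cy -n2 ny.
move: qv; rewrite /v quadZ// exprVn mulrC ler_pdivrMr// exprn_gt0//.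
Qed.

Lemma num_radius_ge0 A : posop A -> 0 <= num_radius A.
Proof. by move=> /num_radiusP[]. Qed.

Lemma quad_le A u : posop A -> inL u -> quad A u <= num_radius A * nrm u ^+ 2.
Proof. by move=> /num_radiusP[_ h _]; exact: h. Qed.

Lemma num_radius_min A C : posop A -> 0 <= C ->
  (forall u, inL u -> quad A u <= C * nrm u ^+ 2) -> num_radius A <= C.
Proof. by move=> /num_radiusP[_ _ h]; exact: h. Qed.

(** Test vector u = e_i + e_j: the entry is a summand of <A u, u>, and u has norm at most 2, whence
    4 = 2^2. *)
Lemma entry_le_num_radius A i j : posop A -> A i j <= 4 * num_radius A.
Proof.
move=> pA.
have [iL ni] := inL_delta hL i; have [jL nj] := inL_delta hL j.
have [uL nu] := inLD iL jL; rewrite ni nj in nu.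
set u := (fun k => _) in uL nu.
have [sq _] := summ_quad pA uL.
have u1 k : (k == i) || (k == j) -> 1 <= u k.
  rewrite /u => /orP[->|->]; first by rewrite lerDl ler0n.
  by rewrite lerDr ler0n.
have w0 := num_radius_ge0 pA.
have n4 : num_radius A * nrm u ^+ 2 <= 4 * num_radius A.
  rewrite mulrC ler_wpM2r//; have -> : 4 = 2 ^+ 2 :> K by ring.
  by rewrite lerXn2r ?nnegrE ?nrm_ge0.
apply: le_trans n4; apply: le_trans (quad_le pA uL).
apply: (le_trans _ (nsum_ge_term i sq)).
have a0 : 0 <= A i j by case: pA.
have le1 : A i j <= act A u i.
  apply: (le_trans _ (nsum_ge_term j (posop_summ i pA uL))).
  by rewrite ler_peMr// u1// eqxx orbT.
apply: (le_trans le1); rewrite ler_peMr ?u1 ?eqxx//.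
exact: le_trans le1.
Qed.

Lemma num_radius_le A B : posop B -> (forall i j, 0 <= A i j <= B i j) ->
  num_radius A <= num_radius B.
Proof.
move=> pB AB; have pA := posop_le pB AB.
apply: num_radius_min => //; first exact: num_radius_ge0.
move=> u uL; apply: le_trans (quad_le pB uL).
have [sq _] := summ_quad pB uL.
apply: (le_nsum _ sq).2 => i; have u0 := inL_ge0 i uL.
rewrite mulr_ge0 ?(inL_ge0 i (posop_inL pA uL))//= ler_wpM2r//.
by apply: (act_le i AB _ pB uL) => j; rewrite (inL_ge0 j uL)/=.
Qed.

Lemma num_radius_sublinear : monotone_sublinear 4
  (fun f : I * I -> K => posop (fun i j => f (i, j)))
  (fun f => num_radius (fun i j => f (i, j))).
Proof.
split=> [f [i j] [f0 _]|f|f [i j] pf|f g pg fg||f g pf pg|r f r0 pf].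
- exact: f0.
- exact: num_radius_ge0.
- exact: (@entry_le_num_radius (fun i j => f (i, j))).
- split; first by apply: (posop_le pg) => i j; exact: fg.
  by apply: num_radius_le => // i j; exact: fg.
- have [p0 a0] := posop0 L; split=> //; apply: num_radius_min => // u uL.
  rewrite /quad a0 mul0r; under eq_fun do rewrite mul0r.
  by apply: (nsum_le _ _).2 => // F; rewrite big1.
- have [pD aD] := posopD pf pg; split=> //.
  apply: num_radius_min => //; first by rewrite addr_ge0 ?num_radius_ge0.
  move=> u uL; rewrite mulrDl.
  apply: (le_trans _ (lerD (quad_le pf uL) (quad_le pg uL))).
  rewrite /quad -(nsumD (summ_quad pf uL).1 (summ_quad pg uL).1).2 aD//.
  by under eq_fun do rewrite mulrDl.
- have [pZ aZ] := posopZ r0 pf; split=> //.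
  apply: num_radius_min => //; first by rewrite mulr_ge0 ?num_radius_ge0.
  move=> u uL; rewrite -mulrA; apply: (le_trans _ (ler_wpM2l r0 (quad_le pf uL))).
  rewrite /quad -(nsumZ r0 (summ_quad pf uL).1).2 aZ//.
  by under eq_fun do rewrite -mulrA.
Qed.

(** For a = 1/m the factor 4^(m a - 1) equals 1; a larger exponent would leave a constant, which is
    why t = m in this part of the theorem. *)
Lemma num_radius_geometric_mean (m : nat) (F : 'I_m -> I -> I -> K) :
  (0 < m)%N -> (forall k, posop (F k)) ->
  num_radius (hadamard_prod (fun k => hadamard_pow (F k) m%:R^-1)) <=
    \prod_(k < m) num_radius (F k) `^ m%:R^-1.
Proof.
move=> m0 pF.
have ma : m%:R / m%:R = 1 :> K by rewrite divff// pnatr_eq0 -lt0n.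
have ma' : 1 <= m%:R / m%:R :> K by rewrite ma.
have k0 : 0 <= 4 :> K by [].
have [_] := @msl_geometric_mean K (I * I) 4 _ _ num_radius_sublinear m m%:R^-1
  (fun k p => F k p.1 p.2) m0 ma' k0 pF.
by rewrite ma subrr powRr0 mul1r.
Qed.

End NumericalRadius.

(** * Cyclic products and the entrywise bound *)

Section CyclicProducts.
Variables (K : realType) (I : choiceType) (L : banach_seq_space K I).
Hypothesis hL : normalized L.
Implicit Types (A B : I -> I -> K).
Local Notation posop := (posop L).

(** Addition in ['I_m.+1] is modulo m + 1. As a translation, the rotation treats the starting index
    k and the position l symmetrically. *)
Lemma rot_enum_ord (m : nat) (k : 'I_m.+1) :
  rot k (enum 'I_m.+1) = [seq k + l | l <- enum 'I_m.+1].
Proof.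
apply: (inj_map val_inj); rewrite map_rot.
transitivity (map (fun l => (k + l) %% m.+1)%N (map val (enum 'I_m.+1))); last first.
  by rewrite -!map_comp; apply: eq_map.
rewrite val_enum_ord; apply: (@eq_from_nth _ 0%N).
  by rewrite size_rot size_map.
rewrite size_rot size_iota => i im; have km := ltn_ord k.
rewrite (nth_map 0%N) ?size_iota// nth_iota// add0n /rot nth_cat size_drop size_iota.
rewrite ltn_subRL; case: ltnP => kim.
  by rewrite nth_drop nth_iota// modn_small.
rewrite nth_take; last by rewrite ltn_subLR ?leq_subr; lia.
by rewrite nth_iota; [rewrite -(subnK kim) modnDr modn_small|]; lia.
Qed.

Lemma mat_prodE (m : nat) (F : 'I_m -> I -> I -> K) :
  mat_prod F = \big[@mat_mul K I/@mat_one K I]_(j <- enum 'I_m) F j.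
Proof. by rewrite /mat_prod enumT /index_enum !unlock. Qed.

(** A rotation swaps the products over [take] and [drop], so this is an instance of
    [mat_rho_mulC]. *)
Lemma mat_rho_cyclic_prod (m : nat) (F : 'I_m -> I -> I -> K) k :
  (forall j, posop (F j)) -> mat_rho L (cyclic_prod F k) <= mat_rho L (mat_prod F).
Proof.
move=> pF; rewrite mat_prodE -(cat_take_drop k (enum 'I_m)) /cyclic_prod /rot.
rewrite (mat_prod_cat hL (drop k _) _ pF) (mat_prod_cat hL (take k _) _ pF).
by apply: (mat_rho_mulC hL); exact: (posop_prod hL).
Qed.

Lemma hadamard_prod1 A (t : K) :
  hadamard_prod (fun _ : 'I_1 => hadamard_pow A t) = hadamard_pow A t.
Proof. by apply/funext => i; apply/funext => j; rewrite /hadamard_prod big_ord1. Qed.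

Section Power.
Variable t : K.
Hypothesis t1 : 1 <= t.
Let t1' : 1 <= 1%:R * t. Proof. by rewrite mul1r. Qed.

(** A Hadamard power is the Hadamard mean of a single factor with exponent t, for which m a >= 1
    reads t >= 1. *)
Lemma hadamard_pow_norm A : posop A ->
  posop (hadamard_pow A t) /\ mat_norm L (hadamard_pow A t) <= mat_norm L A `^ t.
Proof.
move=> pA; have := @hadamard_mean_norm _ _ _ hL 1 t isT t1' (fun=> A) (fun=> pA).
by rewrite hadamard_prod1 big_ord1.
Qed.

Lemma mat_rho_hadamard_pow A : posop A ->
  mat_rho L (hadamard_pow A t) <= mat_rho L A `^ t.
Proof.
move=> pA; have := @mat_rho_hadamard_mean _ _ _ hL 1 t (fun=> A) isT t1' (fun=> pA).
by rewrite hadamard_prod1 big_ord1.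
Qed.

Lemma prod_hadamard_pow (J : Type) (s : seq J) (F : J -> I -> I -> K) i j :
  (forall l, posop (F l)) ->
  0 <= (\big[@mat_mul K I/@mat_one K I]_(l <- s) hadamard_pow (F l) t) i j <=
    hadamard_pow (\big[@mat_mul K I/@mat_one K I]_(l <- s) F l) t i j.
Proof.
move=> pF.
have := @hadamard_mean_prod _ _ _ hL 1 t isT t1' _ s (fun l _ => F l) i j (fun l _ => pF l).
by rewrite hadamard_prod1; under eq_bigr do rewrite hadamard_prod1.
Qed.

End Power.

Lemma hadamard_powK A (t : K) : nonneg_mat A -> t != 0 ->
  hadamard_pow (hadamard_pow A t) t^-1 = A.
Proof.
move=> A0 t0; apply/funext => i; apply/funext => j.
by rewrite /hadamard_pow -powRrM mulfV// powRr1.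
Qed.

(* Write the l-th factor of (A_1 o ... o A_m)^m as A_(1+l) o ... o A_(m+l), indices
   modulo m: the k-th Hadamard columns then multiply to the cyclic products. *)
Lemma mat_exp_hadamard_prod (m : nat) (t : K) (A : 'I_m -> I -> I -> K) i j :
  1 <= t <= m%:R -> (forall k, posop (A k)) ->
  0 <= mat_exp (hadamard_prod A) m i j <=
    hadamard_prod (fun k => hadamard_pow
      (cyclic_prod (fun l => hadamard_pow (A l) t) k) t^-1) i j.
Proof.
case: m A => [|m] A /andP[t1 tm] pA.
  by have := le_trans t1 tm; rewrite ler10.
have t0 : 0 < t := lt_le_trans ltr01 t1.
have mt : 1 <= m.+1%:R * t^-1 by rewrite ler_pdivlMr// mul1r.
pose F (l k : 'I_m.+1) := hadamard_pow (A (k + l)) t.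
have pF l k : posop (F l k) by have [] := hadamard_pow_norm t1 (pA (k + l)).
have FE l : hadamard_prod A = hadamard_prod (fun k => hadamard_pow (F l k) t^-1).
  apply/funext => i'; apply/funext => j'; rewrite /hadamard_prod.
  rewrite (reindex_inj (addIr l)); apply: eq_bigr => k _ /=.
  by rewrite /F hadamard_powK ?gt_eqF//; case: (pA (k + l)).
have -> : mat_exp (hadamard_prod A) m.+1 =
    \big[@mat_mul K I/@mat_one K I]_(l <- enum 'I_m.+1)
      hadamard_prod (fun k => hadamard_pow (F l k) t^-1).
  under eq_bigr do rewrite -FE.
  by rewrite mat_expE big_const_seq count_predT size_enum_ord.
have -> : (fun k => hadamard_pow
      (cyclic_prod (fun l => hadamard_pow (A l) t) k) t^-1) =
    (fun k => hadamard_pow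
      (\big[@mat_mul K I/@mat_one K I]_(l <- enum 'I_m.+1) F l k) t^-1).
  by apply/funext => k; rewrite /cyclic_prod rot_enum_ord big_map.
exact: (hadamard_mean_prod hL).
Qed.

End CyclicProducts.

Theorem theorem3p2 (K : realType) (R : index_set)
    (L : banach_seq_space K (index_type R)) (m : nat)
    (A : 'I_m -> index_type R -> index_type R -> K) (t : K)
    (hL : normalized L)
    (hA0 : forall i, nonneg_mat (A i))
    (hA : forall i, defines_operator L (A i))
    (ht : 1 <= t <= m%:R) :
  let P := cyclic_prod (fun j => hadamard_pow (A j) t) in
  [/\ [/\ mat_rho L (hadamard_prod A) <=
            mat_rho L (hadamard_prod (fun i => hadamard_pow (P i) t^-1))
              `^ m%:R^-1,
          mat_rho L (hadamard_prod (fun i => hadamard_pow (P i) t^-1))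
              `^ m%:R^-1 <=
            mat_rho L (mat_prod (fun j => hadamard_pow (A j) t)) `^ t^-1,
          mat_rho L (mat_prod (fun j => hadamard_pow (A j) t)) `^ t^-1 <=
            mat_rho L (hadamard_pow (mat_prod A) t) `^ t^-1 &
          mat_rho L (hadamard_pow (mat_prod A) t) `^ t^-1 <=
            mat_rho L (mat_prod A)],
      [/\ mat_norm L (mat_exp (hadamard_prod A) m) <=
            mat_norm L (hadamard_prod (fun i => hadamard_pow (P i) t^-1)),
          mat_norm L (hadamard_prod (fun i => hadamard_pow (P i) t^-1)) <=
            (\prod_(i < m) mat_norm L (P i)) `^ t^-1,
          (\prod_(i < m) mat_norm L (P i)) `^ t^-1 <=
            (\prod_(i < m) mat_norm L (hadamard_pow (cyclic_prod A i) t))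
              `^ t^-1 &
          (\prod_(i < m) mat_norm L (hadamard_pow (cyclic_prod A i) t))
              `^ t^-1 <=
            \prod_(i < m) mat_norm L (cyclic_prod A i)] &
      is_l2 L -> t = m%:R ->
      [/\ num_radius (mat_exp (hadamard_prod A) m) <=
            num_radius
              (hadamard_prod (fun i => hadamard_pow (P i) m%:R^-1)),
          num_radius
              (hadamard_prod (fun i => hadamard_pow (P i) m%:R^-1)) <=
            (\prod_(i < m) num_radius (P i)) `^ m%:R^-1 &
          (\prod_(i < m) num_radius (P i)) `^ m%:R^-1 <=
            (\prod_(i < m)
               num_radius (hadamard_pow (cyclic_prod A i) m%:R))
              `^ m%:R^-1]].
Proof.
have pA i : posop L (A i) by exact: defines_operator_posop.
move=> P; have /andP[t1 tm] := ht.
have t0 : 0 < t := lt_le_trans ltr01 t1.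
have ti0 : 0 <= t^-1 by rewrite invr_ge0 ltW.
have mR0 : 0 < m%:R :> K := lt_le_trans t0 tm.
have m0 : (0 < m)%N by rewrite -(ltr0n K).
have mt : 1 <= m%:R * t^-1 by rewrite ler_pdivlMr// mul1r.
have mi0 : 0 <= m%:R^-1 :> K by rewrite invr_ge0 ltW.
pose B j := hadamard_pow (A j) t.
have pB j : posop L (B j) by have [] := hadamard_pow_norm hL t1 (pA j).
have pP i : posop L (P i) by exact: posop_prod.
have pC i : posop L (cyclic_prod A i) by exact: posop_prod.
have pCt i : posop L (hadamard_pow (cyclic_prod A i) t).
  by have [] := hadamard_pow_norm hL t1 (pC i).
have pD : posop L (mat_prod A) by exact: posop_prod.
have pDt : posop L (hadamard_pow (mat_prod A) t).
  by have [] := hadamard_pow_norm hL t1 pD.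
(* Since A_k is the 1/t-th Hadamard power of [B k], the Hadamard product of the A_k is itself a mean
   of the [B k]. *)
have pX : posop L (hadamard_prod A).
  have [+ _] := hadamard_mean_norm hL m0 mt pB.
  suff -> : (fun k => hadamard_pow (B k) t^-1) = A by [].
  by apply/funext => k; rewrite /B hadamard_powK// gt_eqF.
set Q := hadamard_prod (fun i => hadamard_pow (P i) t^-1).
have [pQ nQ] : posop L Q /\ mat_norm L Q <= \prod_(i < m) mat_norm L (P i) `^ t^-1.
  exact: (hadamard_mean_norm hL m0 mt pP).
have XQ i j : 0 <= mat_exp (hadamard_prod A) m i j <= Q i j.
  exact: (mat_exp_hadamard_prod hL).
have PC k i j : 0 <= P k i j <= hadamard_pow (cyclic_prod A k) t i j.
  exact: (prod_hadamard_pow hL).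
have powRK (a : K) : 0 <= a -> (a `^ t) `^ t^-1 = a.
  by move=> a0; rewrite -powRrM mulfV ?gt_eqF// powRr1.
have powmK (a : K) : 0 <= a -> (a ^+ m) `^ m%:R^-1 = a.
  by move=> a0; rewrite -powR_mulrn// -powRrM mulfV ?gt_eqF// powRr1.
have n0 B' : posop L B' -> 0 <= mat_norm L B' by exact: mat_norm_ge0.
have r0 B' : posop L B' -> 0 <= mat_rho L B' by exact: mat_rho_ge0.
have N0 (B' : 'I_m -> _) : (forall k, posop L (B' k)) ->
    0 <= \prod_(k < m) mat_norm L (B' k).
  by move=> pB'; apply: prodr_ge0 => k _; exact: n0.
split.
- split.
  + apply: (le_trans (mat_rho_exp hL pX m0)).
    apply: (le_powR mi0 (r0 _ (posop_exp hL m pX))).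
    exact: (mat_rho_le hL pQ XQ).
  (* The right-hand side is written as the m-th root of an m-th power: each of the m factors in the
     mean inequality is bounded by the same spectral radius, that of the uncycled product. *)
  + rewrite -[leRHS](powmK _ (powR_ge0 _ _)).
    apply: (le_powR mi0 (r0 _ pQ)).
    apply: (le_trans (mat_rho_hadamard_mean hL m0 mt pP)).
    rewrite -[X in _ ^+ X]card_ord -prodr_const; apply: ler_prod => k _.
    rewrite powR_ge0/=; apply: (le_powR ti0 (r0 _ (pP k))).
    exact: (mat_rho_cyclic_prod hL k pB).
  + apply: (le_powR ti0 (r0 _ (posop_prod hL (index_enum 'I_m) pB))).
    apply: (mat_rho_le hL pDt) => i j; exact: (prod_hadamard_pow hL).
  + rewrite -[leRHS](powRK _ (r0 _ pD)); apply: (le_powR ti0 (r0 _ pDt)).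
    exact: (mat_rho_hadamard_pow hL t1 pD).
- split.
  + exact: (mat_norm_le hL pQ XQ).
  + by rewrite powR_prod// => k; exact: (n0 _ (pP k)).
  + apply: (le_powR ti0 (N0 _ pP)).
    apply: ler_prod => k _; rewrite (n0 _ (pP k))/=.
    exact: (mat_norm_le hL (pCt k) (PC k)).
  + rewrite -[leRHS](powRK _ (N0 _ pC)); apply: (le_powR ti0 (N0 _ pCt)).
    rewrite powR_prod => [|k]; last exact: (n0 _ (pC k)).
    apply: ler_prod => k _; rewrite (n0 _ (pCt k))/=.
    by have [] := hadamard_pow_norm hL t1 (pC k).
move=> h2 tE; have w0 B' : posop L B' -> 0 <= num_radius B'.
  exact: (num_radius_ge0 hL h2).
rewrite -tE; split.
- exact: (num_radius_le hL h2 pQ XQ).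
- rewrite powR_prod => [|k]; last exact: (w0 _ (pP k)).
  by rewrite /Q tE; exact: (num_radius_geometric_mean hL h2 m0 pP).
- have wP : 0 <= \prod_(k < m) num_radius (P k).
    by apply: prodr_ge0 => k _; exact: (w0 _ (pP k)).
  apply: (le_powR ti0 wP).
  apply: ler_prod => k _; rewrite (w0 _ (pP k))/=.
  exact: (num_radius_le hL h2 (pCt k) (PC k)).
Qed.
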